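(* Let $(X,\mathsf d,\mathfrak m)$ be a metric measure space, $T>0$, and let $(\boldsymbol b_t)_{t\in(0,T)}\subset\mathrm{Der}^1_{loc}(X,\mathsf d,\mathfrak m)$. Let $\boldsymbol\pi$ be a Borel probability measure on $C([0,T];X)$ concentrated on $AC([0,T];X)$ with $\mu_t:=(\mathrm{ev}_t)_\#\boldsymbol\pi\ll\mathfrak m$ for $\mathscr L^1$-a.e. $t\in(0,T)$, and assume that $$\int_0^T\int_X|\boldsymbol b_t(f)|\,d\mu_t\,dt<\infty\qquad\forall f\in\mathrm{Lip}_{bs}(X).$$ Then the following properties are equivalent: (a) for all $f\in\mathrm{Lip}_{bs}(X)$, $$\frac{d}{dt}f\circ\gamma(t)=\boldsymbol b_t(f)(\gamma(t))\quad\text{for }\mathscr L^1\times\boldsymbol\pi\text{-a.e. }(t,\gamma)\in(0,T)\times C([0,T];X);$$ (b) for all $g\in C_b(C([0,T];X))$ such that $g\boldsymbol\pi$ is a probability measure on $C([0,T];X)$, the curve $\mu^g_t:=(\mathrm{ev}_t)_\#(g\boldsymbol\pi)$, $t\in[0,T]$, solves the continuity equation $\frac{d}{dt}\mu_t+\mathrm{div}(\boldsymbol b_t\mu_t)=0$ with initial datum $\bar\mu=\mu^g_0$.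
   Context: A metric measure space is a complete separable metric space $(X,\mathsf d)$ with a nonnegative Borel measure $\mathfrak m$ finite on bounded sets. $\mathrm{Lip}_b(X)$: bounded Lipschitz functions; $\mathrm{Lip}_{bs}(X)$: Lipschitz functions with bounded support. $C([0,T];X)$ has the sup distance, $AC([0,T];X)$ are absolutely continuous curves, $\mathrm{ev}_t(\gamma)=\gamma(t)$, $C_b$ denotes bounded continuous functions, $\mathscr L^1$ Lebesgue measure. $L^0(X,\mathfrak m)$: real $\mathfrak m$-measurable functions; $L^1_{loc}$: integrability on bounded subsets. Minimal relaxed slope: $\mathrm{Lip}_af(x)=\lim_{r\to0^+}\mathrm{Lip}(f|_{B_r(x)})$; $\mathsf{Ch}(f)=\inf\{\liminf_n\frac12\int\mathrm{Lip}_a^2(f_n)\,d\mathfrak m:\ f_n\in\mathrm{Lip}_b(X)\cap L^2(X,\mathfrak m),\ f_n\to f\text{ in }L^2\}$; for $f\in L^2$ with $\mathsf{Ch}(f)<\infty$, $|\mathrm Df|$ is the element of smallest $L^2$ norm among functions in $L^2$ that are $\ge$ some weak $L^2$ limit of $\mathrm{Lip}_a(f_n)$, $f_n\in\mathrm{Lip}_b\cap L^2$, $f_n\to f$ in $L^2$. For $f\in\mathrm{Lip}_b(X)$, $|\mathrm Df|$ is defined by locality: it equals $|\mathrm Df_R|$ $\mathfrak m$-a.e. on $B_R(\bar x)$ for any $f_R\in\mathrm{Lip}_{bs}(X)$ with $f_R=f$ on $B_R(\bar x)$. Derivations: a derivation is a linear map $\boldsymbol b:\mathrm{Lip}_b(X)\to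 L^0(X,\mathfrak m)$ such that, for some $h\in L^0(X,\mathfrak m)$, $|\boldsymbol b(f)|\le h|\mathrm Df|$ $\mathfrak m$-a.e. for all $f\in\mathrm{Lip}_b(X)$; the smallest such $h$ is $|\boldsymbol b|$; $\mathrm{Der}^1_{loc}$: derivations with $|\boldsymbol b|\in L^1_{loc}(X,\mathfrak m)$. Time-dependent families are understood to be measurable in $(t,x)$. Continuity equation: a curve $(\mu_t)$ of Borel probability measures on $X$ (with $\mu_t\ll\mathfrak m$ for a.e. $t$) solves $\frac{d}{dt}\mu_t+\mathrm{div}(\boldsymbol b_t\mu_t)=0$ with initial datum $\bar\mu$ if $\int_0^T\int_X|\boldsymbol b_t(f)|\,d\mu_t\,dt<\infty$ for all $f\in\mathrm{Lip}_{bs}(X)$ and, for every $f\in\mathrm{Lip}_{bs}(X)$ and $\chi\in C^1_c([0,T))$, $-\int_0^T\chi'(t)\int_Xf\,d\mu_t\,dt=\int_0^T\chi(t)\int_X\boldsymbol b_t(f)\,d\mu_t\,dt+\chi(0)\int_Xf\,d\bar\mu$. *)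

(* Defs.v *)
From HB Require Import structures.
From mathcomp Require Import all_boot all_order all_algebra.
From mathcomp Require Import all_classical all_reals all_analysis.
From mathcomp Require Import lra.

Set Implicit Arguments.
Unset Strict Implicit.
Unset Printing Implicit Defensive.

Import Order.TTheory GRing.Theory Num.Theory.
Import numFieldTopology.Exports numFieldNormedType.Exports.

Local Open Scope classical_set_scope.
Local Open Scope ring_scope.

(** * Metric measure spaces *)

(* The base point comes with the library's complete and measurable types; no
   definition below depends on it, except for junk values. *)
#[short(type="completeMetricType")]
HB.structure Definition CompleteMetric (K : numDomainType) :=
  {X of Complete X & Metric K X}.

Notation borel X := (g_sigma_algebraType (@open X)).

Definition separable (X : topologicalType) :=
  exists2 D : set X, countable D & dense D.

Definition metric_bounded {R : realType} {X : metricType R} (A : set X) :=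
  exists x r, A `<=` ball x r.

Definition metric_measure_space {R : realType} {X : completeMetricType R}
    (m : {measure set (borel X) -> \bar R}) :=
  separable X /\
  forall A : set (borel X), measurable A -> metric_bounded A -> (m A < +oo)%E.

(** * The space of continuous curves on [0, T] with the sup distance *)

(* A function on [0, T] is encoded by its extension to R by the base point. *)
Record curve {R : realType} (T : R) (X : completeMetricType R) := Curve {
  curve_fun :> R -> X ;
  curve_continuous : {within `[0, T], continuous curve_fun} ;
  curve_out : forall t, ~ `[0, T]%classic t -> curve_fun t = point }.

Arguments curve_continuous {R T X} c.

Section curve_metric.
Context {R : realType} {T : R} {X : completeMetricType R}.
Implicit Types (g h k : curve T X) (t : R).

Lemma eq_curve g h : (forall t, `[0, T]%classic t -> g t = h t) -> g = h.
Proof.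
move=> gh; have {gh} : (g : R -> X) = h.
  apply/funext => t; have [/gh//|nt] := pselect (`[0, T]%classic t).
  by rewrite !curve_out.
case: g h => [g cg og] [h ch oh] /= gh; subst h.
by congr Curve; exact: Prop_irrelevance.
Qed.

Lemma point_curve_continuous : {within `[0, T], continuous (fun=> point : X)}.
Proof. exact: cst_continuous. Qed.

Definition point_curve : curve T X :=
  Curve point_curve_continuous (fun _ _ => erefl).

HB.instance Definition _ := gen_eqMixin (curve T X).
HB.instance Definition _ := gen_choiceMixin (curve T X).
HB.instance Definition _ := isPointed.Build (curve T X) point_curve.

Definition sup_dist g h : R := sup [set mdist (g t) (h t) | t in `[0, T]].

Lemma mdist_curve_continuous g h :
  {within `[0, T], continuous (fun t => mdist (g t) (h t))}.
Proof.
move=> t; apply/cvgrPdist_lt => e e0.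
have e2 : 0 < e / 2 by rewrite divr_gt0.
have /metricType_numDomainType.cvgrPdist_lt/(_ _ e2) :=
  curve_continuous g t.
have /metricType_numDomainType.cvgrPdist_lt/(_ _ e2) :=
  curve_continuous h t.
apply: filterS2 => s hs gs.
have := metric_triangle (g t) (g s) (h t).
have := metric_triangle (g s) (h s) (h t).
have := metric_triangle (g s) (g t) (h s).
have := metric_triangle (g t) (h t) (h s).
rewrite (metric_sym (g s) (g t)) (metric_sym (h s) (h t)).
move: hs gs; rewrite /from_subspace/= => hs gs d1 d2 d3 d4.
rewrite ltr_norml; apply/andP; split; lra.
Qed.

Lemma sup_dist_has_ubound g h :
  has_ubound [set mdist (g t) (h t) | t in `[0, T]].
Proof.
have /compact_bounded[M [_ hM]] := continuous_compact
  (@mdist_curve_continuous g h) (@segment_compact R 0 T).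
exists (M + 1) => x Ax.
by apply: le_trans (hM (M + 1) _ x Ax); rewrite ?ler_norm ?ltrDl.
Qed.

Lemma mdist_le_sup_dist g h t :
  `[0, T]%classic t -> mdist (g t) (h t) <= sup_dist g h.
Proof.
by move=> tT; apply: ub_le_sup; [exact: sup_dist_has_ubound|exists t].
Qed.

Lemma sup_dist_le g h x : 0 <= x ->
  (forall t, `[0, T]%classic t -> mdist (g t) (h t) <= x) -> sup_dist g h <= x.
Proof.
move=> x0 ghx; rewrite /sup_dist; set D := [set _ | _ in _].
have [->|/set0P D0] := eqVneq D set0; first by rewrite sup0.
by apply: ge_sup => // _ [t tT <-]; exact: ghx.
Qed.

Lemma sup_dist_ge0 g h : 0 <= sup_dist g h.
Proof.
rewrite /sup_dist; set D := [set _ | _ in _].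
have [->|/set0P[_ [t tT _]]] := eqVneq D set0; first by rewrite sup0.
exact: le_trans (mdist_ge0 _ _) (mdist_le_sup_dist _ _ tT).
Qed.

Lemma sup_distxx g : sup_dist g g = 0.
Proof.
apply/eqP; rewrite eq_le sup_dist_ge0 andbT.
by apply: sup_dist_le => // t _; rewrite mdistxx.
Qed.

Lemma sup_dist_positivity g h : sup_dist g h = 0 -> g = h.
Proof.
move=> gh0; apply: eq_curve => t tT; apply: (@mdist_positivity R X).
apply/eqP; rewrite eq_le mdist_ge0 andbT -gh0; exact: mdist_le_sup_dist.
Qed.

Lemma sup_dist_sym g h : sup_dist g h = sup_dist h g.
Proof.
rewrite /sup_dist; congr sup.
by apply/seteqP; split => _ [t tT <-]; exists t => //; exact: metric_sym.
Qed.

Lemma sup_dist_triangle h g k : sup_dist g k <= sup_dist g h + sup_dist h k.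
Proof.
apply: sup_dist_le => [|t tT]; first by rewrite addr_ge0// sup_dist_ge0.
by rewrite (le_trans (metric_triangle _ (h t) _))// lerD// mdist_le_sup_dist.
Qed.

HB.instance Definition _ := @isMetric.Build R (curve T X) sup_dist
  sup_distxx sup_dist_positivity sup_dist_sym sup_dist_triangle.

Definition ev t (g : borel (curve T X)) : borel X := (g : curve T X) t.

Lemma ev_measurable t : measurable_fun setT (ev t).
Proof.
apply: (@measurability _ _ (borel (curve T X)) (borel X) setT (ev t)
  (@open X) erefl) => _ [U oU <-].
rewrite setTI; have [tT|nt] := pselect (`[0, T]%classic t); last first.
  have -> : ev t = cst point.
    by apply/funext => g; rewrite /ev curve_out.
  rewrite preimage_cst; case: ifP => _; [exact: measurableT|exact: measurable0].
apply: sub_sigma_algebra; rewrite openE => /= g /= Ug.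
move: oU; rewrite openE => /(_ _ Ug); rewrite /interior => /nbhs_ballP[e e0 eU].
apply/nbhs_ballP; exists e => // h; rewrite ballEmdist/= => gh.
apply: eU; rewrite ballEmdist/=.
exact: le_lt_trans (mdist_le_sup_dist _ _ tT) gh.
Qed.

HB.instance Definition _ t :=
  isMeasurableFun.Build _ _ _ _ (ev t) (ev_measurable t).

End curve_metric.

(* Absolute continuity in the sense of metric spaces: the distance between two
   points of the curve is controlled by the integral of an L^1 function. *)
Definition abs_continuous_curve {R : realType} {T : R}
    {X : completeMetricType R} (g : curve T X) :=
  exists2 v : R -> R,
    (@lebesgue_measure R).-integrable `]0, T[ (EFin \o v) &
    forall s t, 0 <= s -> s <= t -> t <= T ->
      mdist (g s) (g t) <= \int[@lebesgue_measure R]_(r in `]s, t[) v r.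

(** * Lipschitz functions and slopes *)

Section lipschitz.
Context {R : realType} {X : metricType R}.
Implicit Types (f : X -> R) (A : set X).

Definition lipschitz_fun f :=
  exists L, forall x y, `|f x - f y| <= L * mdist x y.

Definition Lip_b f := lipschitz_fun f /\ bounded_fun f.

Definition Lip_bs f :=
  lipschitz_fun f /\ metric_bounded (closure [set x | f x != 0]).

(* The diagonal pairs contribute 0 / 0 = 0, so that the constant of a
   function on a singleton is 0. *)
Definition lip_cst f A : R :=
  sup [set `|f p.1 - f p.2| / mdist p.1 p.2 | p in A `*` A].

Definition lip_a f x : R := lim (lip_cst f (ball x r) @[r --> 0^'+]).

End lipschitz.

(* Elements of L^0 and L^2, which are classes modulo equality m-a.e., are
   handled through Borel representatives; every class of m-measurable
   functions has one. *)
Section slopes.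
Context {R : realType} {X : completeMetricType R}
  (m : {measure set (borel X) -> \bar R}).
Implicit Types (f g : X -> R).

Definition L2 : set (X -> R) := [set f | f \in Lfun m 2%:E].

Definition cvg_L2 (f_ : nat -> X -> R) f :=
  ('N[m]_2%:E [EFin \o (f_ n \- f)%R] @[n --> \oo] --> 0)%E.

Definition weak_cvg_L2 (f_ : nat -> X -> R) f :=
  forall phi, L2 phi ->
    (\int[m]_x (f_ n x * phi x)) @[n --> \oo] --> (\int[m]_x (f x * phi x)).

Definition lip_approx f (f_ : nat -> X -> R) :=
  (forall n, Lip_b (f_ n) /\ L2 (f_ n)) /\ cvg_L2 f_ f.

Definition Ch f : \bar R :=
  ereal_inf [set limn_einf (fun n =>
    ((2^-1)%:E * \int[m]_x (lip_a (f_ n) x ^+ 2)%:E)%E) | f_ in lip_approx f].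

Definition relaxed_slope f g :=
  L2 g /\ exists (f_ : nat -> X -> R) (h : X -> R), [/\ lip_approx f f_,
    (forall n, L2 (lip_a (f_ n))) /\ L2 h,
    weak_cvg_L2 (fun n => lip_a (f_ n)) h &
    \forall x \ae m, h x <= g x].

(* [g] is (a representative of) the minimal relaxed slope |Df| *)
Definition min_relaxed_slope f g :=
  [/\ L2 f, (Ch f < +oo)%E, relaxed_slope f g &
    forall g', relaxed_slope f g' ->
      ('N[m]_2%:E [EFin \o g] <= 'N[m]_2%:E [EFin \o g'])%E].

(* [g] is |Df| for [f] in Lip_b *)
Definition lip_slope f g :=
  measurable_fun [set: borel X] g /\
  forall (x : X) r (fr gr : X -> R), 0 < r -> Lip_bs fr ->
    (forall y, ball x r y -> fr y = f y) -> min_relaxed_slope fr gr ->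
    g = gr %[ae m in ball x r].

End slopes.

(** * Derivations *)

Section derivations.
Context {R : realType} {X : completeMetricType R}
  (m : {measure set (borel X) -> \bar R}).
Implicit Types (b : (X -> R) -> X -> R) (h : X -> R).

(* Nonnegativity has to be required for a smallest such h to exist, since h
   is unconstrained where all slopes vanish. *)
Definition derivation_bound b h :=
  [/\ measurable_fun [set: borel X] h, \forall x \ae m, 0 <= h x &
    forall f df, Lip_b f -> lip_slope m f df ->
      \forall x \ae m, `|b f x| <= h x * df x].

(* Only the values of b on Lip_b are relevant. *)
Definition derivation b :=
  [/\ forall f, Lip_b f -> measurable_fun [set: borel X] (b f),
    forall a f g, Lip_b f -> Lip_b g ->
      \forall x \ae m, b (fun y => a * f y + g y) x = a * b f x + b g x &
    exists h, derivation_bound b h].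

(* [h] is (a representative of) |b| *)
Definition derivation_norm b h :=
  derivation_bound b h /\
  forall h', derivation_bound b h' -> \forall x \ae m, h x <= h' x.

Definition L1_loc h :=
  forall A : set (borel X), measurable A -> metric_bounded A ->
    m.-integrable A (EFin \o h).

Definition Der1_loc b :=
  derivation b /\ exists2 h, derivation_norm b h & L1_loc h.

(* (t, x) |-> b_t(f)(x) is measurable for the completion of L^1 x m. *)
Definition time_measurable (T : R) (b : R -> (X -> R) -> X -> R) :=
  forall f, Lip_b f ->
    exists2 B : measurableTypeR R * borel X -> R, measurable_fun setT B &
      \forall z \ae (@lebesgue_measure R \x m)%E,
        `]0, T[%classic z.1 -> b z.1 f z.2 = B z.

End derivations.

(** * The continuity equation *)

Section continuity_equation.
Context {R : realType} {X : completeMetricType R}.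

(* C^1_c([0, T)): the restrictions to [0, T) of C^1 functions on R that vanish
   on [s, +oo) for some s < T. *)
Definition C1_c (T : R) (chi : R -> R) :=
  [/\ forall t, derivable chi t 1, continuous (derive1 chi) &
    exists2 s, s < T & forall t, s <= t -> chi t = 0].

Definition summable_along (T : R) (b : R -> (X -> R) -> X -> R)
    (mu : R -> probability (borel X) R) :=
  forall f, Lip_bs f ->
    ((\int[@lebesgue_measure R]_(t in `]0%R, T[)
       (\int[mu t]_x `|b t f x|%:E)) < +oo)%E.

(* The measures [mu t] with [t] outside [0, T] are irrelevant. *)
Definition solves_continuity_equation
    (m : {measure set (borel X) -> \bar R}) (T : R)
    (b : R -> (X -> R) -> X -> R)
    (mu : R -> probability (borel X) R) (mu0 : probability (borel X) R) :=
  [/\ \forall t \ae @lebesgue_measure R, `]0, T[%classic t -> mu t `<< m,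
    summable_along T b mu &
    forall f chi, Lip_bs f -> C1_c T chi ->
      - (\int[@lebesgue_measure R]_(t in `]0, T[)
           (derive1 chi t * (\int[mu t]_x f x))) =
      (\int[@lebesgue_measure R]_(t in `]0, T[)
         (chi t * (\int[mu t]_x b t f x))) + chi 0 * (\int[mu0]_x f x)].

End continuity_equation.

(* Main.v *)
Require Import Defs.
From HB Require Import structures.
From mathcomp Require Import all_boot all_order all_algebra.
From mathcomp Require Import all_classical all_reals all_analysis.
From mathcomp Require Import measurable_realfun lra ring.

(** The proof fixes [f] in [Lip_bs] and compares, along a curve [c], the
    function [obs f c : t |-> f (c t)] with [vel B c : t |-> B (t, c t)], where
    [B] is a jointly measurable version of [(t, x) |-> b t f x].  As the time
    marginals of [pi] are absolutely continuous, so is the law of [(t, c t)]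
    under [dt * pi] with respect to [dt * m]; hence [vel B c t] is
    [b t f (c t)] for almost every [(t, c)] ([ae_along_curves]), under [pi] and
    under each reweighted measure [g * pi].  By Fubini's theorem, the continuity
    equation for [g * pi], tested with [f] and [chi], says that the functional

      [Psi c = \int_0^T (chi' * obs f c + chi * vel B c) dt + chi 0 * f (c 0)]

    has integral [0] with respect to [g * pi] ([continuity_equationE]).

    From (a) to (b).  For almost every [c], the function [obs f c] is absolutely
    continuous with derivative [vel B c], and [Psi c = 0] is an integration by
    parts ([weak_derivative]).  The underlying fundamental theorem of calculus
    ([integral_derivative]) follows from Fatou's lemma, which bounds the integral
    of the derivative of a monotone function by its increment: if [V] is a
    primitive that dominates the increments of [F], then these bounds for [V + F]
    and [V - F] add up to an equality.

    From (b) to (a).  As [g] is arbitrary, [Psi] is orthogonal to all bounded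
    continuous functions, so [Psi c = 0] for almost every [c]
    ([ae_eq0_of_continuous_duality]), and this for countably many [chi] at once.
    Countably many [chi], with tent functions as derivatives, suffice to
    show that [obs f c] is a primitive of [vel B c] ([is_derive_of_weak]).  So for
    almost every [c] the derivative is the right one at almost every [t].  The
    passage to almost every pair [(t, c)] uses that the exceptional set is
    measurable ([measurable_not_is_derive]).

    For [t] in a null set of times, [x |-> b t f x] is unrelated to [B], and the
    integrals in the continuity equation need not depend measurably on [t].
    This does no harm since the integral, a supremum over simple functions, does
    not see null sets ([ae_eq_integral_nomeas]). *)

Set Implicit Arguments.
Unset Strict Implicit.
Unset Printing Implicit Defensive.

Import Order.TTheory GRing.Theory Num.Theory.
Import numFieldTopology.Exports numFieldNormedType.Exports.

Local Open Scope classical_set_scope.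
Local Open Scope ring_scope.

(** * Integrals of almost everywhere equal functions *)

Lemma ae_imp d (T : measurableType d) (R : realType)
    (mu : {measure set T -> \bar R}) (P Q : T -> Prop) :
  (forall x, P x -> Q x) -> (\forall x \ae mu, P x) -> \forall x \ae mu, Q x.
Proof. exact: filterS. Qed.

Lemma ae_imp2 d (T : measurableType d) (R : realType)
    (mu : {measure set T -> \bar R}) (P Q S : T -> Prop) :
  (forall x, P x -> Q x -> S x) ->
  (\forall x \ae mu, P x) -> (\forall x \ae mu, Q x) -> \forall x \ae mu, S x.
Proof. exact: filterS2. Qed.

Import HBNNSimple.

(** The integral of a nonnegative function is a supremum over the simple
    functions below it, and such a simple function may be cut off on a null set
    without changing its integral.  Hence almost everywhere equal functions have
    the same integral, measurable or not. *)
Lemma ae_le_nnintegral d (T : measurableType d) (R : realType)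
    (mu : {measure set T -> \bar R}) (f g : T -> \bar R) :
  (forall x, (0 <= f x)%E) -> (forall x, (0 <= g x)%E) ->
  (\forall x \ae mu, f x = g x) -> (\int[mu]_x f x <= \int[mu]_x g x)%E.
Proof.
move=> f0 g0 [N [mN N0 fgN]]; rewrite !ge0_integralTE//.
apply: ge_ereal_sup => _ [h hf <-].
pose h' := proj_nnsfun h (measurableC mN).
apply: ereal_sup_ubound; exists h'.
  move=> x; rewrite /h' -mrestrict patchE; case: ifPn => [|_]; last exact: g0.
  rewrite inE => Nx; suff <- : f x = g x by exact: hf.
  by apply: contrapT => fgx; apply: Nx; exact: fgN.
have -> : sintegral mu h' = (\int[mu]_(x in ~` N) (h x)%:E)%E.
  rewrite -integralT_nnsfun [RHS]integral_mkcond; apply: eq_integral => x _.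
  by rewrite /h' -mrestrict !patchE; case: ifP.
rewrite -integralT_nnsfun.
rewrite [RHS](@ge0_negligible_integral _ _ _ mu setT N)//; last 2 first.
- exact/measurable_EFinP.
- by move=> x _; rewrite /= lee_fin.
by rewrite setTD.
Qed.

Lemma ae_eq_integral_nomeas d (T : measurableType d) (R : realType)
    (mu : {measure set T -> \bar R}) (D : set T) (f g : T -> \bar R) :
  ae_eq mu D f g -> (\int[mu]_(x in D) f x = \int[mu]_(x in D) g x)%E.
Proof.
move=> fg.
have {}fg : ae_eq mu setT (f \_ D) (g \_ D).
  apply: filterS fg => x fgx _; rewrite !patchE.
  by case: ifPn => //; rewrite inE => /fgx.
have [fgp fgn] := (ae_eq_funeposneg _ _ _ _).1 fg.
rewrite [LHS]integral_mkcond [RHS]integral_mkcond [LHS]integralE [RHS]integralE.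
by congr (_ - _)%E; apply/eqP; rewrite eq_le !ae_le_nnintegral//;
  by [apply: filterS fgp => x /(_ I)|apply: filterS fgn => x /(_ I)].
Qed.

Lemma ae_eq_Rintegral d (T : measurableType d) (R : realType)
    (mu : {measure set T -> \bar R}) (D : set T) (f g : T -> R) :
  ae_eq mu D f g -> \int[mu]_(x in D) f x = \int[mu]_(x in D) g x.
Proof.
move=> fg; congr fine; apply: ae_eq_integral_nomeas.
by apply: filterS fg => x + Dx => /(_ Dx) ->.
Qed.

Section integrable_real_valued.
Context d (T : measurableType d) (R : realType) (mu : {measure set T -> \bar R}).
Variables (D : set T) (mD : measurable D).
Implicit Types f g : T -> R.

Lemma integrable_addr f g :
  mu.-integrable D (EFin \o f) -> mu.-integrable D (EFin \o g) ->
  mu.-integrable D (EFin \o (fun x => f x + g x)).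
Proof.
by move=> fi gi; exact: (eq_integrable mD _ _ (fun _ _ => erefl)
  (integrableD mD fi gi)).
Qed.

Lemma integrable_subr f g :
  mu.-integrable D (EFin \o f) -> mu.-integrable D (EFin \o g) ->
  mu.-integrable D (EFin \o (fun x => f x - g x)).
Proof.
by move=> fi gi; exact: (eq_integrable mD _ _ (fun _ _ => erefl)
  (integrableB mD fi gi)).
Qed.

Lemma integrable_scaler (k : R) f : mu.-integrable D (EFin \o f) ->
  mu.-integrable D (EFin \o (fun x => k * f x)).
Proof.
by move=> fi; exact: (eq_integrable mD _ _ (fun _ _ => erefl)
  (integrableZl mD k fi)).
Qed.

Lemma integrable_bounded_mulr (h f : T -> R) (M : R) :
  measurable_fun D h -> (forall x, D x -> `|h x| <= M) ->
  mu.-integrable D (EFin \o f) ->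
  mu.-integrable D (EFin \o (fun x => h x * f x)).
Proof.
move=> mh hM fi; have mf : measurable_fun D f.
  by apply/measurable_EFinP; exact: measurable_int fi.
apply: (le_integrable mD _ _ (integrable_scaler M fi)).
  by apply/measurable_EFinP; exact: measurable_funM.
move=> x Dx /=; rewrite lee_fin !normrM ler_wpM2r//.
exact: le_trans (hM x Dx) (ler_norm _).
Qed.

End integrable_real_valued.

(** * Absolutely continuous functions of a real variable *)

Lemma ge0_integral_shift (R : realType) (f : R -> \bar R) (h a b : R) :
  measurable_fun setT f -> (forall x, (0 <= f x)%E) ->
  (\int[@lebesgue_measure R]_(x in `]a, b[) f (x + h)%R =
   \int[@lebesgue_measure R]_(x in `](a + h)%R, (b + h)%R[) f x)%E.
Proof.
move=> mf f0.
pose s : measurableTypeR R -> measurableTypeR R := fun x => x + h.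
have ms : measurable_fun setT s by exact: measurable_funD.
have shE (u v : R) (p q : bool) :
    s @^-1` [set` Interval (BSide p (u + h)) (BSide q (v + h))] =
    [set` Interval (BSide p u) (BSide q v)].
  by apply/seteqP; split => x /=; rewrite /s !in_itv/= !lteifD2r.
have sm (A : set (measurableTypeR R)) : measurable A ->
    pushforward (@lebesgue_measure R) s A = lebesgue_measure A.
  move=> mA; apply/esym/lebesgue_measure_unique => //= _ [[r t]] _ <-.
  have -> : pushforward (@lebesgue_measure R) s `]r, t]%classic =
      lebesgue_measure (`](r - h), (t - h)]%classic : set R).
    by have := shE (r - h) (t - h) false false; rewrite !subrK /pushforward => ->.
  rewrite !lebesgue_measure_itv/= !lte_fin ltrD2r.
  by case: ifP => // _; rewrite -!EFinB; congr EFin; ring.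
transitivity (\int[@lebesgue_measure R]_(x in s @^-1` `](a + h)%R, (b + h)%R[)
  (f \o s) x)%E; first by rewrite shE.
rewrite -(ge0_integral_pushforward ms)//; last exact: measurable_funTS.
by apply: eq_measure_integral => //= A mA _; exact: sm.
Qed.

(** Extend [G] by constants outside [[a, b]] and apply Fatou's lemma to the
    difference quotients [(G (x + h) - G x) / h]: they are nonnegative, and
    their integral over [(a, b)] is at most the mean of [G] over [(b, b + h)]
    minus [G a]. *)
Lemma integral_derivative_le (R : realType) (G w : R -> R) (a b : R) :
  a < b -> {in `[a, b] &, {homo G : x y / x <= y}} ->
  (\forall x \ae @lebesgue_measure R,
     `]a, b[%classic x -> is_derive x (1 : R) G (w x)) ->
  (\int[@lebesgue_measure R]_(x in `]a, b[) (w x)%:E <= (G b - G a)%:E)%E.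
Proof.
move=> ab ndG dG.
pose c (x : R) := Num.min (Num.max x a) b.
have cE x : x \in `[a, b] -> c x = x.
  by rewrite in_itv/= => /andP[ax xb]; rewrite /c max_l// min_l.
have cab x : c x \in `[a, b].
  by rewrite in_itv/= /c le_min ge_min lexx orbT !andbT le_max lexx orbT ltW.
have ndc : {homo c : x y / x <= y}.
  move=> x y xy; rewrite /c le_min ge_min ge_min lexx !orbT andbT.
  by rewrite ge_max !le_max xy lexx/= orbT.
pose g x := G (c x) - G a.
have ndg : {homo g : x y / x <= y}.
  by move=> x y xy; rewrite lerD2r; apply: ndG => //; exact: ndc.
have a_ab : a \in `[a, b] by rewrite in_itv/= lexx ltW.
have b_ab : b \in `[a, b] by rewrite in_itv/= lexx ltW.
have g0 x : 0 <= g x.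
  rewrite subr_ge0; apply: ndG => //.
  by have := cab x; rewrite in_itv/= => /andP[].
have gb x : b <= x -> g x = G b - G a.
  move=> bx; rewrite /g /c min_r// le_max bx//.
have mg : measurable_fun setT g by exact: nondecreasing_measurable.
pose h n : R := n.+1%:R^-1.
have h0 n : 0 < h n by rewrite invr_gt0.
pose D n x := ((h n)^-1 * (g (x + h n) - g x))%:E.
have mshift n : measurable_fun setT (fun x : R => g (x + h n)).
  by apply: nondecreasing_measurable => // x y xy; apply: ndg; rewrite lerD2r.
have mD n : measurable_fun `]a, b[ (D n).
  apply/measurable_EFinP/measurable_funTS/measurable_funM => //.
  exact: measurable_funB.
have D0 n x : (0 <= D n x)%E.
  rewrite lee_fin mulr_ge0//; first by rewrite invr_ge0 ltW.
  rewrite subr_ge0; apply: ndg.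
  by rewrite lerDl ltW.
have Dw : ae_eq (@lebesgue_measure R) `]a, b[%classic
    (fun x => limn_einf (D ^~ x)) (EFin \o w).
  apply: ae_imp dG => x dGx xab.
  have [dx dxw] := dGx xab.
  have h_cvg : h n @[n --> \oo] --> 0 by exact: cvg_harmonic.
  have /cvgr_dnbhsP/(_ h) : (r^-1 *: ((G \o shift x) (r *: (1 : R)) - G x))
      @[r --> 0^'] --> w x by rewrite -dxw; exact: dx.
  move=> /(_ (conj (fun n => lt0r_neq0 (h0 n)) h_cvg)) Gw.
  have xab' : a < x < b by move: xab; rewrite /= in_itv.
  have /andP[ax xb] := xab'.
  have gw : (h n)^-1 * (g (x + h n) - g x) @[n --> \oo] --> w x.
    apply: cvg_trans Gw; apply: near_eq_cvg.
    have : \forall n \near \oo, h n < b - x.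
      move/cvgrPdist_lt : h_cvg => /(_ (b - x)); rewrite subr_gt0 => /(_ xb).
      by apply: filterS => n; rewrite sub0r normrN gtr0_norm.
    apply: filterS => n hn /=.
    have E1 : c (x + h n) = x + h n.
      apply: cE; rewrite in_itv/= (le_trans (ltW ax)) ?lerDl ?ltW//=.
      by rewrite -ltrBrDl.
    have E2 : c x = x by apply: cE; rewrite in_itv/= !ltW.
    by rewrite /g E1 E2 /GRing.scale/= mulr1 (addrC (h n)); ring.
  by apply: (cvg_limn_einf_sup _).1; apply: cvg_EFin; [exact: nearW|exact: gw].
have mI : measurable (`]a, b[%classic : set R) by exact: measurable_itv.
have <- := ae_eq_integral_nomeas Dw.
have F := @fatou _ _ _ (@lebesgue_measure R) _ mI D mD (fun n x _ => D0 n x).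
apply: (le_trans F).
rewrite limn_einf_lim; apply: lime_le; first exact: is_cvg_einfs.
apply: nearW => n.
apply: (@le_trans _ _ (\int[@lebesgue_measure R]_(x in `]a, b[) D n x)%E).
  by apply: ereal_inf_lbound; exists n => /=.
have mgE (A : set R) : measurable_fun A (fun x => (g x)%:E).
  exact/measurable_EFinP/measurable_funTS.
have gE0 (A : set R) x : A x -> (0 <= (g x)%:E)%E by rewrite lee_fin.
set I := (\int[@lebesgue_measure R]_(x in `]a, b[) (g x)%:E)%E.
have J : (\int[@lebesgue_measure R]_(x in `]a, b[) (g (x + h n)%R)%:E <=
          I + ((G b - G a) * h n)%:E)%E.
  rewrite (@ge0_integral_shift _ (fun x => (g x)%:E))//.
  apply: (@le_trans _ _
      (\int[@lebesgue_measure R]_(x in `]a, (b + h n)%R[) (g x)%:E)%E).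
    apply: ge0_subset_integral => //.
    - exact: mgE.
    - by move=> x _; rewrite lee_fin.
    - by apply: subset_itvr; rewrite bnd_simp lerDl ltW.
  rewrite (@itv_bndbnd_setU _ _ (BRight a) (BRight b)); last 2 first.
    by rewrite bnd_simp ltW.
    by rewrite bnd_simp ltrDl.
  rewrite ge0_integral_setU//=; last 3 first.
    exact: mgE.
    by move=> x _; rewrite lee_fin.
    apply/disj_setPS => x [] /=; rewrite !in_itv/= => /andP[_ xb] /andP[bx _].
    by move: bx; rewrite ltNge xb.
  rewrite -integral_itv_bndo_bndc; last exact: mgE.
  apply: leeD => //.
  under eq_integral => x.
    rewrite inE/= in_itv/= => /andP[bx _]; rewrite gb ?ltW//.
    over.
  rewrite integral_cst//= lebesgue_measure_itv/= lte_fin ltrDl h0.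
  by rewrite -EFinD addrAC subrr add0r.
have mK : measurable_fun `]a, b[ (fun x => (g (x + h n) - g x)%:E).
  by apply/measurable_EFinP/measurable_funTS; exact: measurable_funB.
have K0 x : (0 <= (g (x + h n) - g x)%:E)%E.
  by rewrite lee_fin subr_ge0; apply: ndg; rewrite lerDl ltW.
set K := (\int[@lebesgue_measure R]_(x in `]a, b[) (g (x + h n) - g x)%:E)%E.
have JE : (\int[@lebesgue_measure R]_(x in `]a, b[) (g (x + h n)%R)%:E =
           K + I)%E.
  rewrite -ge0_integralD//; last 2 first.
    by move=> x _; rewrite lee_fin.
    exact: mgE.
  by apply: eq_integral => x _; rewrite -EFinD subrK.
have Ifin : I \is a fin_num.
  rewrite ge0_fin_numE; last by apply: integral_ge0 => x _; rewrite lee_fin.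
  apply: (@le_lt_trans _ _
      (\int[@lebesgue_measure R]_(x in `]a, b[) (cst (G b - G a)%:E x))%E).
    apply: ge0_le_integral => //; [by move=> x _; rewrite lee_fin|exact: mgE|].
    move=> x; rewrite /= in_itv/= => /andP[_ xb]; rewrite lee_fin -(gb b)//.
    by apply: ndg; rewrite ltW.
  rewrite integral_cst//= lebesgue_measure_itv/= lte_fin ab.
  by rewrite -EFinB -EFinM ltry.
have DE : (\int[@lebesgue_measure R]_(x in `]a, b[) D n x = (h n)^-1%:E * K)%E.
  by rewrite -ge0_integralZl_EFin// invr_ge0 ltW.
move: J; rewrite JE addeC leeD2lE// DE => KM.
apply: (@le_trans _ _ ((h n)^-1%:E * ((G b - G a) * h n)%:E)%E).
  by apply: lee_wpmul2l => //; rewrite lee_fin invr_ge0 ltW.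
by rewrite -EFinM mulrCA mulVf ?mulr1// gt_eqF.
Qed.

Section absolutely_continuous.
Context {R : realType} (T : R) (T0 : 0 < T).
Notation lam := (@lebesgue_measure R).
Implicit Types (v w F : R -> R).

Lemma integrable_itv_sub w s t : lam.-integrable `]0, T[ (EFin \o w) ->
  0 <= s -> t <= T -> lam.-integrable `]s, t[ (EFin \o w).
Proof.
move=> iw s0 tT; apply: integrableS iw; [exact: measurable_itv|
  exact: measurable_itv|].
move=> r /=; rewrite !in_itv/= => /andP[sr rt].
by rewrite (le_lt_trans s0 sr) (lt_le_trans rt tT).
Qed.

Lemma primitive_sub w s t : lam.-integrable `]0, T[ (EFin \o w) ->
  0 <= s -> s <= t -> t <= T ->
  \int[lam]_(r in `]0, t[) w r - \int[lam]_(r in `]0, s[) w r =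
  \int[lam]_(r in `]s, t[) w r.
Proof.
move=> iw s0; rewrite le_eqVlt => /predU1P[<- sT|st tT].
  by rewrite subrr set_itvoo0 Rintegral_set0.
have i0 := integrable_itv_sub iw (lexx 0) tT.
rewrite -(@Rintegral_itvB _ _ (BRight 0) (BLeft t) s)//.
congr (_ - _); apply: Rintegral_itv_bndo_bndc.
by apply: (integrable_itv_sub iw) => //; rewrite (le_trans _ tT)// ltW.
Qed.

Lemma primitive_is_derive w : lam.-integrable `]0, T[ (EFin \o w) ->
  \forall t \ae lam, `]0, T[%classic t ->
    is_derive t (1 : R) (fun t => \int[lam]_(r in `]0, t[) w r) (w t).
Proof.
move=> iw.
have locw : locally_integrable setT (w \_ `]0, T[%classic).
  exact: integrable_locally.
have iwT : lam.-integrable setT (EFin \o w \_ `]0, T[%classic).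
  by rewrite -restrict_EFin -integrable_mkcond.
have iwy y : lam.-integrable [set` Interval (BRight 0) (BRight y)]
    (EFin \o w \_ `]0, T[%classic).
  by apply: integrableS iwT => //; exact: measurable_itv.
apply: ae_imp (FTC1 iwy locw) => t dW tT.
have t0T : 0 < t < T by move: tT; rewrite /= in_itv.
have /andP[t0 t1] := t0T.
have := dW; rewrite lte_fin => /(_ t0)[dWt Wt].
have nE : \forall s \near t, \int[lam]_(r in `]0, s]) (w \_ `]0, T[%classic) r =
    \int[lam]_(r in `]0, s[) w r.
  near=> s.
  rewrite -Rintegral_itv_bndo_bndc; last first.
    by apply: integrableS iwT => //; exact: measurable_itv.
  apply: eq_Rintegral => r; rewrite inE/= in_itv/= => /andP[r0 rs].
  rewrite patchE ifT// inE/= in_itv/= r0/= (lt_trans rs)//.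
  by near: s; exact: lt_nbhsl.
apply: (near_eq_is_derive nE).
split; first exact: dWt.
by move: Wt; rewrite derive1E => ->; rewrite patchE ifT// inE.
Unshelve. all: by end_near. Qed.

(** If the increments of [F] are dominated by those of the integral [V] of [v],
    then [V + F] and [V - F] are nondecreasing; the inequalities between their
    increments and the integrals of their derivatives, [v + w] and [v - w], add
    up to the trivial identity for [2 V], so both are equalities. *)
Lemma integral_derivative F v w :
  lam.-integrable `]0, T[ (EFin \o v) -> lam.-integrable `]0, T[ (EFin \o w) ->
  (forall s t : R, 0 <= s -> s <= t -> t <= T ->
    `|F t - F s| <= \int[lam]_(r in `]s, t[) v r) ->
  (\forall t \ae lam, `]0, T[%classic t -> is_derive t (1 : R) F (w t)) ->
  \int[lam]_(r in `]0, T[) w r = F T - F 0.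
Proof.
move=> iv iw Fv dF.
pose V t := \int[lam]_(r in `]0, t[) v r.
have dV := primitive_is_derive iv.
have VB s t : 0 <= s -> s <= t -> t <= T ->
  V t - V s = \int[lam]_(r in `]s, t[) v r by exact: primitive_sub.
have mI : measurable (`]0, T[%classic : set R) by exact: measurable_itv.
have key (G : R -> R) (u : R -> R) : lam.-integrable `]0, T[ (EFin \o u) ->
    (forall s t : R, 0 <= s -> s <= t -> t <= T -> G s <= G t) ->
    (\forall t \ae lam, `]0, T[%classic t -> is_derive t (1 : R) G (u t)) ->
    \int[lam]_(r in `]0, T[) u r <= G T - G 0.
  move=> iu ndG dG; rewrite -lee_fin fineK; last exact: integrable_fin_num.
  apply: integral_derivative_le => // s t; rewrite !in_itv/=.
  by move=> /andP[s0 _] /andP[_ tT] st; exact: ndG.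
have V0 : V 0 = 0 by rewrite /V set_itvoo0 Rintegral_set0.
have VT : \int[lam]_(r in `]0, T[) v r = V T by [].
have le1 : \int[lam]_(r in `]0, T[) (v r + w r) <= (V T + F T) - (V 0 + F 0).
  apply: (key (fun t => V t + F t) (fun t => v t + w t)); first exact: integrable_addr.
    move=> s t s0 st tT; have := Fv _ _ s0 st tT; rewrite -VB// ler_norml.
    by lra.
  by apply: ae_imp2 dV dF => t dVt dFt tT; apply: is_deriveD; [exact: dVt|exact: dFt].
have le2 : \int[lam]_(r in `]0, T[) (v r - w r) <= (V T - F T) - (V 0 - F 0).
  apply: (key (fun t => V t - F t) (fun t => v t - w t)); first exact: integrable_subr.
    move=> s t s0 st tT; have := Fv _ _ s0 st tT; rewrite -VB// ler_norml.
    by lra.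
  by apply: ae_imp2 dV dF => t dVt dFt tT; apply: is_deriveB; [exact: dVt|exact: dFt].
move: le1 le2; rewrite RintegralD// RintegralB// VT V0.
lra.
Qed.

End absolutely_continuous.

Section weak_derivative.
Context {R : realType} (T : R) (T0 : 0 < T).
Notation lam := (@lebesgue_measure R).
Implicit Types (v w F chi : R -> R).

Let mI : measurable (`]0, T[%classic : set R).
Proof. exact: measurable_itv. Qed.

Lemma continuous_within_bounded F : {within `[0, T], continuous F} ->
  exists M : R, forall t : R, 0 <= t -> t <= T -> `|F t| <= M.
Proof.
move=> cF; have /compact_bounded[M [_ hM]] :=
  continuous_compact cF (@segment_compact R 0 T).
exists (M + 1) => t t0 tT; apply: (hM (M + 1)); first by rewrite ltrDl.
by exists t => //=; rewrite in_itv/= t0.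
Qed.

Lemma continuous_within_measurable F : {within `[0, T], continuous F} ->
  measurable_fun `]0, T[ F.
Proof.
move=> cF; apply: (@measurable_funS _ _ _ _ `[0, T]%classic) => //.
  exact: subset_itv_oo_cc.
by apply: subspace_continuous_measurable_fun => //; exact: measurable_itv.
Qed.

Lemma integrable_continuousM F w : {within `[0, T], continuous F} ->
  lam.-integrable `]0, T[ (EFin \o w) ->
  lam.-integrable `]0, T[ (EFin \o (fun t => F t * w t)).
Proof.
move=> cF iw; have [M FM] := continuous_within_bounded cF.
apply: (@integrable_bounded_mulr _ _ _ lam _ mI F w M) => //.
  exact: continuous_within_measurable.
move=> t /=; rewrite in_itv/= => /andP[t0 tT].
by apply: FM; exact: ltW.
Qed.

Lemma integrable_itv_cst (c : R) : lam.-integrable `]0, T[ (EFin \o cst c).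
Proof.
apply: measurable_bounded_integrable => //.
  by rewrite /= lebesgue_measure_itv/= lte_fin T0 -EFinB ltry.
by exists `|c|; split => // M cM x _; exact: ltW.
Qed.

Lemma primitive_continuous w : lam.-integrable `]0, T[ (EFin \o w) ->
  {within `[0, T], continuous (fun t => \int[lam]_(r in `]0, t[) w r)}.
Proof.
move=> iw; pose wT := w \_ `]0, T[%classic.
have iwT : lam.-integrable setT (EFin \o wT).
  by rewrite -restrict_EFin -integrable_mkcond.
have iwS (A : set R) : measurable A -> lam.-integrable A (EFin \o wT).
  by move=> mA; apply: integrableS iwT.
have := parameterized_integral_continuous (ltW T0) (iwS _ (measurable_itv `[0, T])).
apply: subspace_eq_continuous => t; rewrite inE/= in_itv/= => /andP[t0 tT].
transitivity (\int[lam]_(r in `]0, t]) wT r).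
  apply/esym; apply: Rintegral_itv_obnd_cbnd.
  by apply: iwS; exact: measurable_itv.
rewrite -Rintegral_itv_bndo_bndc; last by apply: iwS; exact: measurable_itv.
apply: eq_Rintegral => r; rewrite inE/= in_itv/= => /andP[r0 rt].
by rewrite /wT patchE ifT// inE/= in_itv/= r0/= (lt_le_trans rt).
Qed.

Lemma lipschitz_of_continuous_derivative chi :
  (forall t : R, derivable chi t 1) -> continuous (derive1 chi) ->
  exists2 M : R, 0 <= M & forall s t : R, 0 <= s -> s <= t -> t <= T ->
    `|chi t - chi s| <= M * (t - s).
Proof.
move=> dchi cchi.
have [M hM] := continuous_within_bounded
  (continuous_subspaceT cchi : {within `[0, T], continuous (derive1 chi)}).
have M0 : 0 <= M by apply: le_trans (hM 0 _ _) => //; exact: ltW.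
exists M => // s t s0 st tT.
have [|||c] := @MVT_segment _ chi (derive1 chi) s t => //.
- by move=> x _; split=> //; rewrite derive1E.
- apply: continuous_subspaceT => x.
  by apply: differentiable_continuous; exact/derivable1_diffP.
rewrite in_itv/= => /andP[sc ct] ->.
rewrite normrM (@ger0_norm _ (t - s)) ?subr_ge0// ler_wpM2r ?subr_ge0//.
by apply: hM; [exact: le_trans sc|exact: le_trans tT].
Qed.

(** The fundamental theorem of calculus for [chi * F], which is again absolutely
    continuous and vanishes at [T]. *)
Lemma weak_derivative F v w chi :
  lam.-integrable `]0, T[ (EFin \o v) -> lam.-integrable `]0, T[ (EFin \o w) ->
  {within `[0, T], continuous F} ->
  (forall s t : R, 0 <= s -> s <= t -> t <= T ->
    `|F t - F s| <= \int[lam]_(r in `]s, t[) v r) ->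
  (\forall t \ae lam, `]0, T[%classic t -> is_derive t (1 : R) F (w t)) ->
  (forall t : R, derivable chi t 1) -> continuous (derive1 chi) -> chi T = 0 ->
  \int[lam]_(t in `]0, T[) (derive1 chi t * F t + chi t * w t) =
  - (chi 0 * F 0).
Proof.
move=> iv iw cF Fv dF dchi cdchi chiT.
have cchi : {within `[0, T], continuous chi}.
  apply: continuous_subspaceT => x.
  by apply: differentiable_continuous; exact/derivable1_diffP.
have [C1 hC1] := continuous_within_bounded cchi.
have [C2 C20 hC2] := lipschitz_of_continuous_derivative dchi cdchi.
have [C3 hC3] := continuous_within_bounded cF.
have C10 : 0 <= C1 by apply: le_trans (hC1 0 _ _) => //; exact: ltW.
have C30 : 0 <= C3 by apply: le_trans (hC3 0 _ _) => //; exact: ltW.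
rewrite (@integral_derivative _ _ T0 (fun t => chi t * F t)
  (fun r => C1 * v r + C3 * C2)).
- by rewrite chiT mul0r sub0r.
- by apply: integrable_addr => //; [exact: integrable_scaler|
    exact: integrable_itv_cst].
- apply: integrable_addr => //; last exact: integrable_continuousM.
  have := integrable_continuousM cF (integrable_continuousM (continuous_subspaceT cdchi) (integrable_itv_cst 1)).
  by apply: eq_integrable => // t _ /=; rewrite mulr1 mulrC.
- move=> s t s0 st tT.
  have ivst := integrable_itv_sub iv s0 tT.
  have mst : measurable (`]s, t[%classic : set R) by exact: measurable_itv.
  rewrite RintegralD//; last 2 first.
    exact: integrable_scaler.
    exact: integrable_itv_sub (integrable_itv_cst _) s0 tT.
  rewrite RintegralZl// Rintegral_cst//= lebesgue_measure_itv/= lte_fin.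
  have -> : fine (if s < t then (t%:E - s%:E)%E else 0%E) = t - s.
    case: ltP => //= ts; apply/eqP; rewrite eq_sym subr_eq0 eq_le ts.
    by rewrite st.
  have -> : chi t * F t - chi s * F s =
    chi t * (F t - F s) + (chi t - chi s) * F s by ring.
  rewrite (le_trans (ler_normD _ _))// !normrM; apply: lerD.
    apply: ler_pM => //; last exact: Fv.
    by apply: hC1 => //; exact: le_trans st.
  rewrite mulrC -mulrA; apply: ler_pM => //; last exact: hC2.
  by apply: hC3 => //; exact: le_trans tT.
- apply: ae_imp dF => t dFt tT.
  have dt : is_derive t (1 : R) chi (derive1 chi t).
    by split=> //; rewrite derive1E.
  have := is_deriveM dt (dFt tT).
  by rewrite /GRing.scale/= addrC (mulrC (F t)).
Qed.

End weak_derivative.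

(** * Test functions that determine a derivative *)

Section cutoff.
Context {R : realType}.
Implicit Types x q h t : R.

Definition pos_sqr x : R := Num.max 0 x ^+ 2.

Lemma pos_sqr_is_derive x : is_derive x (1 : R) pos_sqr (2 * Num.max 0 x).
Proof.
have [x0|x0|->] := ltgtP x 0.
- rewrite mulr0.
  apply: (@near_eq_is_derive _ _ _ (cst (0 : R))).
  near=> y; rewrite /pos_sqr max_l ?expr0n//=; apply/ltW.
  by near: y; exact: lt_nbhsl.
- apply: (@near_eq_is_derive _ _ _ (fun y : R => y ^+ 2)).
    near=> y; rewrite /pos_sqr max_r//; apply/ltW.
    by near: y; exact: lt_nbhsr.
  apply: (is_derive_eq (is_deriveM (is_derive_id x (1 : R)) (is_derive_id x 1))).
  by rewrite /GRing.scale/= mulr1 mulr_natl.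
- rewrite mulr0.
  have c0 : h^-1 *: ((pos_sqr \o shift 0) (h *: (1 : R)) - pos_sqr 0)
      @[h --> 0^'] --> (0 : R).
    apply/cvgrPdist_lt => e e0; near=> h.
    rewrite /pos_sqr /GRing.scale/= maxxx expr0n/= subr0 mulr1 addr0 sub0r.
    rewrite normrN normrM.
    have h0 : h != 0 by near: h; exact: nbhs_dnbhs_neq.
    apply: (@le_lt_trans _ _ `|h|); last first.
      by near: h; exact: dnbhs0_lt.
    rewrite normfV ler_pdivrMl ?normr_gt0// -expr2 normrX.
    apply: lerXn2r; rewrite ?nnegrE//.
    by have [] := leP 0 h; rewrite ?normr0.
  by split; [apply/cvg_ex; exists 0|apply/cvg_lim].
Unshelve. all: by end_near. Qed.

(** A C^1 function that vanishes for [t >= q + 2 h] and whose derivative is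
    minus twice a tent over [[q, q + 2 h]]: the second difference in [a] of the
    functions [t |-> (max 0 (a - t)) ^ 2]. *)
Definition cutoff q h t : R :=
  pos_sqr (q - t) - 2 * pos_sqr (q + h - t) + pos_sqr (q + 2 * h - t).

Definition tent q h t : R :=
  Num.max 0 (q - t) - 2 * Num.max 0 (q + h - t) + Num.max 0 (q + 2 * h - t).

Lemma cutoff_is_derive q h t :
  is_derive t (1 : R) (cutoff q h) (- (2 * tent q h t)).
Proof.
have D a : is_derive t (1 : R) (fun s => pos_sqr (a - s))
    (- (2 * Num.max 0 (a - t))).
  have db : is_derive t (1 : R) (fun s => a - s) (-1).
    by have := is_deriveB (is_derive_cst a t 1) (is_derive_id t (1 : R)); rewrite sub0r.
  have := @is_derive1_comp _ pos_sqr (fun s => a - s) t _ _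
    (pos_sqr_is_derive (a - t)) db.
  by rewrite mulrN1.
have := is_deriveD (is_deriveB (D q) (is_deriveZ 2 (D (q + h)))) (D (q + 2 * h)).
by congr is_derive; rewrite /GRing.scale/= /tent; ring.
Qed.

Lemma tent_ge0 q h t : 0 <= h -> 0 <= tent q h t.
Proof.
move=> h0; rewrite /tent.
have [] := leP 0 (q - t); have [] := leP 0 (q + h - t);
  have [] := leP 0 (q + 2 * h - t); lra.
Qed.

Lemma tent_out q h t : 0 <= h -> t <= q \/ q + 2 * h <= t -> tent q h t = 0.
Proof.
move=> h0 tqh; rewrite /tent.
have [] := leP 0 (q - t); have [] := leP 0 (q + h - t);
  have [] := leP 0 (q + 2 * h - t); case: tqh; lra.
Qed.

Lemma cutoff_right q h t : 0 <= h -> q + 2 * h <= t -> cutoff q h t = 0.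
Proof.
move=> h0 qht; rewrite /cutoff /pos_sqr !max_l; [ring|lra|lra|lra].
Qed.

Lemma cutoff_left q h t : 0 <= h -> t <= q -> cutoff q h t = 2 * h ^+ 2.
Proof.
move=> h0 qht; rewrite /cutoff /pos_sqr !max_r; [ring|lra|lra|lra].
Qed.

Lemma derive1_cutoff q h : derive1 (cutoff q h) = (fun t => - (2 * tent q h t)).
Proof.
by apply/funext => t; rewrite derive1E; have [_ ->] := cutoff_is_derive q h t.
Qed.

Lemma tent_continuous q h : continuous (tent q h).
Proof.
have C a : continuous (fun t : R => Num.max 0 (a - t)).
  move=> t; apply: (@continuous_max _ _ (cst 0) (fun s : R => a - s) t); first exact: cvg_cst.
  by apply: cvgB; [exact: cvg_cst|exact: cvg_id].
move=> t; apply: cvgD; last exact: C.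
by apply: cvgB; [exact: C|apply: cvgMr; exact: C].
Qed.

Lemma cutoff_C1_c T q h : 0 <= h -> q + 2 * h < T -> C1_c T (cutoff q h).
Proof.
move=> h0 qhT; split.
- by move=> t; have [] := cutoff_is_derive q h t.
- rewrite derive1_cutoff => t; apply: cvgN; apply: cvgMr.
  exact: tent_continuous.
- by exists (q + 2 * h) => // t; exact: cutoff_right.
Qed.

End cutoff.

Section primitive_of_weak.
Context {R : realType} (T : R) (T0 : 0 < T).
Notation lam := (@lebesgue_measure R).
Implicit Types (w F chi : R -> R).

Let mI : measurable (`]0, T[%classic : set R).
Proof. exact: measurable_itv. Qed.

(** With [chi 0 * F 0] added, this is the distribution [w - F'] applied to
    [chi]. *)
Definition weak_pairing F w chi : R :=
  \int[lam]_(t in `]0, T[) (derive1 chi t * F t + chi t * w t).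

Lemma weak_pairing_integrable F w chi : {within `[0, T], continuous F} ->
  lam.-integrable `]0, T[ (EFin \o w) -> C1_c T chi ->
  lam.-integrable `]0, T[
    (EFin \o (fun t => derive1 chi t * F t + chi t * w t)).
Proof.
move=> cF iw [dchi cdchi _].
have cchi : {within `[0, T], continuous chi}.
  apply: continuous_subspaceT => x.
  by apply: differentiable_continuous; exact/derivable1_diffP.
apply: integrable_addr => //; last exact: integrable_continuousM.
have := integrable_continuousM cF (integrable_continuousM
  (continuous_subspaceT cdchi) (integrable_itv_cst T0 1)).
by apply: eq_integrable => // t _ /=; rewrite mulr1 mulrC.
Qed.

(** By integration by parts, [K = F - F 0 - W], where [W] is the primitive of [w],
    is orthogonal to all tents.  If [c * K] were larger than some [e > 0] near
    [t], then testing with a small tent close to [t] would give a positive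
    integral. *)
Lemma weak_solution_le0 F w (c t : R) :
  {within `[0, T], continuous F} -> lam.-integrable `]0, T[ (EFin \o w) ->
  (forall (q : rat) n, 0 < ratr q :> R -> ratr q + 2 * n.+1%:R^-1 < T ->
    weak_pairing F w (cutoff (ratr q) n.+1%:R^-1) =
    - (cutoff (ratr q) n.+1%:R^-1 0 * F 0)) ->
  0 < t -> t < T ->
  c * (F t - F 0 - \int[lam]_(r in `]0, t[) w r) <= 0.
Proof.
move=> cF iw weakF t0 tT; rewrite leNgt; apply/negP => cK0.
pose W t := \int[lam]_(r in `]0, t[) w r.
have cW : {within `[0, T], continuous W} by exact: primitive_continuous.
pose K t := F t - F 0 - W t; pose e := c * K t / 2.
have e0 : 0 < e by rewrite divr_gt0.
have cK : {for t, continuous (fun s => c * K s)}.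
  have tI : t \in `]0, T[ by rewrite in_itv/= t0.
  have [cFt _ _] := (continuous_within_itvP F T0).1 cF.
  have [cWt _ _] := (continuous_within_itvP W T0).1 cW.
  apply: cvgMr; apply: cvgB; last exact: cWt.
  by apply: cvgB; [exact: cFt|exact: cvg_cst].
have [d d0 Kd] : exists2 d, 0 < d & forall s, `|t - s| < d -> e < c * K s.
  have : \forall s \near t, e < c * K s.
    by apply: (cvgr_gt _ cK); move: e0; rewrite /e; lra.
  by case/nbhs_ballP => d d0 dK; exists d.
pose d' := Num.min d (T - t).
have d'0 : 0 < d' by rewrite lt_min d0 subr_gt0.
(* [q] and [h] are such that [[q, q + 2 h]] lies in [(t, t + d')]. *)
have [q /andP[tq qd]] : exists q : rat, t < ratr q < t + d' / 2.
  have [|q] := @rat_in_itvoo R t (t + d' / 2); first by rewrite ltrDl divr_gt0.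
  by rewrite in_itv; exists q.
have [n nd] : exists n, n.+1%:R^-1 < d' / 4 :> R.
  have [n _ /(_ n (leqnn n)) nd] := near_infty_natSinv_lt (PosNum (divr_gt0 d'0 (ltr0n R 4))).
  by exists n.
set h : R := n.+1%:R^-1; have h0 : 0 < h by rewrite invr_gt0.
have d'd : d' <= d by rewrite ge_min lexx.
have d'T : d' <= T - t by rewrite ge_min lexx orbT.
have q0 : 0 < ratr q :> R by exact: lt_trans tq.
have qhT : ratr q + 2 * h < T by move: nd; rewrite -/h; lra.
pose chi := cutoff (ratr q) h.
have Cchi : C1_c T chi by apply: cutoff_C1_c => //; exact: ltW.
have [dchi cdchi _] := Cchi.
have chiT : chi T = 0 by apply: cutoff_right; exact: ltW.
have chi0 : chi 0 = 2 * h ^+ 2 by apply: cutoff_left; exact: ltW.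
have i0 := integrable_itv_cst T0 0.
have c1 : {within `[0, T], continuous (cst 1 : R -> R)}.
  by apply: continuous_subspaceT; exact: cst_continuous.
have wpF : weak_pairing F w chi = - (chi 0 * F 0) by exact: weakF.
have wpW : weak_pairing W w chi = 0.
  transitivity (- (chi 0 * W 0)); last first.
    by rewrite /W set_itvoo0 Rintegral_set0 mulr0 oppr0.
  apply: (@weak_derivative _ _ T0 W (fun r => `|w r|) w chi _ iw cW _ _
    dchi cdchi chiT).
  - exact: integrable_norm.
  - move=> s u s0 su uT; rewrite (primitive_sub iw)//; apply: le_normr_Rintegral.
      exact: measurable_itv.
    exact: (integrable_itv_sub iw).
  - exact: primitive_is_derive.
have wp1 : weak_pairing (cst 1) (cst 0) chi = - chi 0.
  transitivity (- (chi 0 * 1)); last by rewrite mulr1.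
  apply: (@weak_derivative _ _ T0 (cst 1) (cst (0 : R)) (cst (0 : R)) chi i0 i0 c1 _ _
    dchi cdchi chiT).
  - by move=> s u *; rewrite subrr normr0 Rintegral_ge0.
  - by apply: aeW => u _; exact: is_derive_cst.
have iF := weak_pairing_integrable cF iw Cchi.
have iW := weak_pairing_integrable cW iw Cchi.
have i1 := weak_pairing_integrable c1 i0 Cchi.
have wpK : \int[lam]_(s in `]0, T[)
    (c * ((derive1 chi s * F s + chi s * w s)
     - (derive1 chi s * W s + chi s * w s)
     - F 0 * (derive1 chi s * cst 1 s + chi s * cst 0 s))) = 0.
  rewrite RintegralZl//; last first.
    by apply: integrable_subr => //; [exact: integrable_subr|exact: integrable_scaler].
  rewrite RintegralB//; last 2 first.
    exact: integrable_subr.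
    exact: integrable_scaler.
  rewrite RintegralB// RintegralZl//.
  rewrite -!/(weak_pairing _ _ _) wpF wpW wp1; ring.
have : \int[lam]_(s in `]0, T[)
    (c * ((derive1 chi s * F s + chi s * w s)
     - (derive1 chi s * W s + chi s * w s)
     - F 0 * (derive1 chi s * cst 1 s + chi s * cst 0 s))) <=
  \int[lam]_(s in `]0, T[) (e * (derive1 chi s * cst 1 s + chi s * cst 0 s)).
  apply: le_Rintegral => //.
  - apply: integrable_scaler => //.
    by apply: integrable_subr => //; [exact: integrable_subr|exact: integrable_scaler].
  - exact: integrable_scaler.
  move=> s _; rewrite derive1_cutoff/= mulr1 mulr0 addr0.
  set D := tent _ _ _.
  have -> : c * (- (2 * D) * F s + chi s * w s -
      (- (2 * D) * W s + chi s * w s) - F 0 * - (2 * D)) =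
    - (2 * D) * (c * K s) by rewrite /K; ring.
  rewrite (mulrC e).
  have D0 : 0 <= D by apply: tent_ge0; exact: ltW.
  have [sq|qs] := leP s (ratr q).
    have -> : D = 0 by apply: tent_out; [exact: ltW|left].
    by rewrite mulr0 oppr0 !mul0r.
  have [qhs|sqh] := leP (ratr q + 2 * h) s.
    have -> : D = 0 by apply: tent_out; [exact: ltW|right].
    by rewrite mulr0 oppr0 !mul0r.
  have eK : e < c * K s.
    apply: Kd; rewrite ltr_norml; move: nd; rewrite -/h => nd.
    by clear - tq qd qs sqh d'd nd; apply/andP; split; lra.
  by rewrite !mulNr lerN2; apply: ler_wpM2l; [rewrite mulr_ge0|exact: ltW].
rewrite wpK RintegralZl// -/(weak_pairing _ _ _) wp1 chi0.
rewrite mulrN oppr_ge0 leNgt => /negP; apply.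
by apply: mulr_gt0 => //; apply: mulr_gt0 => //; exact: exprn_gt0.
Qed.

(** [weak_solution_le0] for [c = 1] and [c = - 1] shows that [F] is a primitive of
    [w], which Lebesgue's theorem differentiates.  The index set is countable so
    that the hypothesis can hold for almost every curve simultaneously. *)
Lemma is_derive_of_weak F w :
  {within `[0, T], continuous F} -> lam.-integrable `]0, T[ (EFin \o w) ->
  (forall (q : rat) n, 0 < ratr q :> R -> ratr q + 2 * n.+1%:R^-1 < T ->
    weak_pairing F w (cutoff (ratr q) n.+1%:R^-1) =
    - (cutoff (ratr q) n.+1%:R^-1 0 * F 0)) ->
  \forall t \ae lam, `]0, T[%classic t -> is_derive t (1 : R) F (w t).
Proof.
move=> cF iw weakF.
have FW t : 0 < t -> t < T -> F t = F 0 + \int[lam]_(r in `]0, t[) w r.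
  move=> t0 tT; have := weak_solution_le0 1 cF iw weakF t0 tT.
  have := weak_solution_le0 (- 1) cF iw weakF t0 tT.
  rewrite mulN1r mul1r; lra.
apply: ae_imp (primitive_is_derive iw) => t dW tT.
have t0T : 0 < t < T by move: tT; rewrite /= in_itv.
have /andP[t0 t1] := t0T.
have := is_deriveD (is_derive_cst (F 0) t (1 : R)) (dW tT).
rewrite add0r; apply: near_eq_is_derive; near=> s.
have s0 : 0 < s by near: s; exact: lt_nbhsr.
have s1 : s < T by near: s; exact: lt_nbhsl.
by rewrite [RHS]FW.
Unshelve. all: by end_near. Qed.

End primitive_of_weak.

(** * Null sets and integrals on products *)

Lemma product_null_xsection d1 d2 (T1 : measurableType d1)
    (T2 : measurableType d2) (R : realType)
    (m1 : {measure set T1 -> \bar R})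
    (m2 : {sigma_finite_measure set T2 -> \bar R}) (A : set (T1 * T2)) :
  measurable A ->
  (m1 \x m2)%E A = 0%E <-> \forall x \ae m1, m2 (xsection A x) = 0%E.
Proof.
move=> mA; have mf := measurable_fun_xsection m2 mA.
have := ae_eq_integral_abs m1 measurableT mf.
have -> : (\int[m1]_x `|(m2 \o xsection A) x| = (m1 \x m2) A)%E.
  by apply: eq_integral => x _; rewrite gee0_abs.
move=> ->; split; apply: ae_imp => x //=; exact.
Qed.

Lemma product_null_ysection d1 d2 (T1 : measurableType d1)
    (T2 : measurableType d2) (R : realType)
    (m1 : {sigma_finite_measure set T1 -> \bar R})
    (m2 : {sigma_finite_measure set T2 -> \bar R}) (A : set (T1 * T2)) :
  measurable A ->
  (m1 \x m2)%E A = 0%E <-> \forall y \ae m2, m1 (ysection A y) = 0%E.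
Proof.
move=> mA; have mf := measurable_fun_ysection m1 mA.
have := ae_eq_integral_abs m2 measurableT mf.
have -> : (\int[m2]_y `|(m1 \o ysection A) y| = (m1 \x m2) A)%E.
  rewrite (@product_measure_unique _ _ _ _ _ m1 m2 (m1 \x^ m2)%E)//.
    by apply: eq_integral => x _; rewrite gee0_abs.
  by move=> B C mB mC /=; rewrite product_measure2E.
move=> ->; split; apply: ae_imp => x //=; exact.
Qed.

(** A function of [(t, w)] that is continuous in [t] and measurable in [w] is
    jointly measurable: it is the limit of the functions obtained by rounding
    [t] down to a multiple of [1 / (n + 1)]. *)
Lemma measurable_caratheodory d (R : realType) (W : measurableType d)
    (X : completeMetricType R) (Phi : R -> W -> X) :
  (forall w, continuous (Phi ^~ w)) ->
  (forall t, measurable_fun setT (Phi t : W -> borel X)) ->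
  measurable_fun setT
    (fun z : measurableTypeR R * W => Phi z.1 z.2 : borel X).
Proof.
move=> cPhi mPhi.
pose r n (t : R) : R := (Num.floor (t * n.+1%:R))%:~R / n.+1%:R.
have rP n t : r n t <= t < r n t + n.+1%:R^-1.
  rewrite /r ler_pdivrMr// floor_le/= -[X in _ + X]mul1r -mulrDl.
  by rewrite ltr_pdivlMr// -(intrD R _ 1) floorD1_gt.
have r_cvg t : r n t @[n --> \oo] --> t.
  apply/cvgrPdist_lt => e e0.
  have := near_infty_natSinv_lt (PosNum e0); apply: filterS => n /= ne.
  have /andP[r1 r2] := rP n t.
  by rewrite ger0_norm ?subr_ge0// (lt_trans _ ne)// ltrBlDl.
have mr n (Y : set (borel X)) : measurable Y ->
    measurable [set z : measurableTypeR R * W | Y (Phi (r n z.1) z.2)].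
  move=> mY.
  have -> : [set z : measurableTypeR R * W | Y (Phi (r n z.1) z.2)] =
    \bigcup_(k : int) ([set t : measurableTypeR R | Num.floor (t * n.+1%:R) = k]
      `*` (Phi (k%:~R / n.+1%:R) @^-1` Y)).
    apply/seteqP; split => [[t w] /= Yz|[t w] /= [k _ [/= <-]]//].
    by exists (Num.floor (t * n.+1%:R)).
  apply: countable_bigcupT_measurable => // k; apply: measurableX.
    have -> : [set t : measurableTypeR R | Num.floor (t * n.+1%:R) = k] =
      `[k%:~R / n.+1%:R, (k + 1)%:~R / n.+1%:R[%classic.
      apply/seteqP; split => t /=; rewrite in_itv/= ler_pdivrMr// ltr_pdivlMr//.
        by move=> <-; rewrite floor_le floorD1_gt.
      by move=> /floor_def.
    exact: measurable_itv.
  by rewrite -[X in measurable X]setTI; exact: mPhi.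
apply: (@measurability _ _ (measurableTypeR R * W)%type (borel X) setT _
  (@open X) erefl) => _ [U oU <-]; rewrite setTI.
pose V k := [set x : X | ball x k.+1%:R^-1 `<=` U].
have mV k : measurable (V k : set (borel X)).
  rewrite -[V k]setCK; apply: measurableC; apply: sub_sigma_algebra.
  rewrite openE => x /= /existsNP[y /not_implyP[xy Uy]].
  rewrite ballEmdist/= in xy.
  apply/nbhs_ballP; exists (k.+1%:R^-1 - mdist x y); first by rewrite /= subr_gt0.
  move=> x'; rewrite ballEmdist/= => xx' Vx'; apply: Uy; apply: Vx'.
  rewrite ballEmdist/=; apply: le_lt_trans (metric_triangle _ x _) _.
  by rewrite metric_sym -ltrBrDr.
have -> : (fun z : measurableTypeR R * W => Phi z.1 z.2 : borel X) @^-1` U =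
    \bigcup_k \bigcup_N \bigcap_(n in [set n | (N <= n)%N])
      [set z : measurableTypeR R * W | V k (Phi (r n z.1) z.2)].
  apply/seteqP; split => [[t w] /= Uz|[t w] /= [k _ [N _ NV]]].
    have : nbhs (Phi t w) U by apply: open_nbhs_nbhs; split.
    case/nbhs_ballP => e /= e0 eU.
    have e2 : 0 < e / 2 by rewrite divr_gt0.
    have [k _ /(_ k (leqnn k)) /= ke] := near_infty_natSinv_lt (PosNum e2).
    have : Phi (r n t) w @[n --> \oo] --> Phi t w.
      exact: (cvg_comp _ _ (r_cvg t) (cPhi w t)).
    move=> /metricType_numDomainType.cvgrPdist_lt/(_ _ e2)[N _ NP].
    exists k => //; exists N => // n /= Nn y; rewrite ballEmdist/= => ny.
    apply: eU; rewrite ballEmdist/=.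
    apply: le_lt_trans (metric_triangle _ (Phi (r n t) w) _) _.
    by rewrite (splitr e) ltrD// ?(lt_trans ny)//; exact: NP.
  have k0 : 0 < k.+1%:R^-1 :> R by rewrite invr_gt0.
  have : Phi (r n t) w @[n --> \oo] --> Phi t w.
    exact: (cvg_comp _ _ (r_cvg t) (cPhi w t)).
  move=> /metricType_numDomainType.cvgrPdist_lt/(_ _ k0)[M _ MP].
  apply: (NV (maxn N M)); rewrite /= ?leq_maxl// ballEmdist/= metric_sym.
  by apply: MP; rewrite /= leq_maxr.
apply: bigcupT_measurable => k; apply: bigcupT_measurable => N.
by apply: bigcap_measurable => [|n _]; [exists N => /=|exact: mr].
Qed.

Section fubini_strip.
Context d (R : realType) (W : measurableType d) (P : probability W R).
Notation lam := (@lebesgue_measure R).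
Variables (A : set (measurableTypeR R)) (mA : measurable A).
Variable Phi : measurableTypeR R * W -> R.
Hypothesis mPhi : measurable_fun setT Phi.

Let Psi (z : measurableTypeR R * W) : R := \1_A z.1 * Phi z.

Let mPsi : measurable_fun setT (EFin \o Psi).
Proof.
apply/measurable_EFinP/measurable_funM => //.
by apply: measurableT_comp => //; exact: measurable_indic.
Qed.

Let mAT : measurable (A `*` [set: W]).
Proof. exact: measurableX. Qed.

Let PsiE : EFin \o Psi = (EFin \o Phi) \_ (A `*` setT).
Proof.
apply/funext => -[t w]; rewrite patchE /Psi/= indicE.
case: ifPn => [|tA]; first by rewrite inE => -[/= tA _]; rewrite mem_set// mul1r.
rewrite memNset ?mul0r// => tA'; move: tA; rewrite notin_setE; apply.
by split.
Qed.

Lemma strip_integrableP :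
  (\int[lam]_(t in A) \int[P]_w `|Phi (t, w)|%:E < +oo)%E ->
  (lam \x P)%E.-integrable (A `*` setT) (EFin \o Phi).
Proof.
move=> intPhi; apply/integrable_mkcond => //; rewrite -PsiE.
apply/integrable12ltyP => //.
rewrite (le_lt_trans _ intPhi)// [leRHS]integral_mkcond.
rewrite le_eqVlt; apply/orP; left; apply/eqP; apply: eq_integral => t _.
rewrite patchE; case: ifPn => tA.
  by apply: eq_integral => w _; rewrite /Psi /= indicE tA mul1r.
by apply: integral0_eq => w _; rewrite /Psi /= indicE (negbTE tA) mul0r normr0.
Qed.

Hypothesis iPhi : (lam \x P)%E.-integrable (A `*` setT) (EFin \o Phi).

Let iPsi : (lam \x P)%E.-integrable setT (EFin \o Psi).
Proof. by rewrite PsiE; exact: (integrable_mkcond _ mAT).1. Qed.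

Lemma strip_ae_integrable1 :
  \forall t \ae lam, A t -> P.-integrable setT (fun w => (Phi (t, w))%:E).
Proof.
apply: ae_imp (ae_integrable1 iPsi) => t it At.
by apply: eq_integrable it => // w _; rewrite /= /Psi/= indicE mem_set// mul1r.
Qed.

Let restrictE (w : W) : (fun t => (Psi (t, w))%:E) =
  (fun t => (Phi (t, w))%:E) \_ A.
Proof.
apply/funext => t; rewrite patchE /Psi/= indicE.
by case: ifPn => tA; rewrite ?mul1r ?mul0r.
Qed.

Lemma strip_ae_integrable2 :
  \forall w \ae P, lam.-integrable A (fun t => (Phi (t, w))%:E).
Proof.
apply: ae_imp (ae_integrable2 iPsi) => w iw.
by apply/integrable_mkcond => //; rewrite -restrictE.
Qed.

Let fin2 : \forall w \ae P,
  (\int[lam]_t (Psi (t, w))%:E = (\int[lam]_(t in A) Phi (t, w))%:E)%E.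
Proof.
apply: ae_imp strip_ae_integrable2 => w iw.
rewrite restrictE -integral_mkcond /Rintegral fineK//.
exact: integrable_fin_num.
Qed.

Lemma strip_integrable :
  P.-integrable setT (fun w => (\int[lam]_(t in A) Phi (t, w))%:E).
Proof.
have mG := measurable_fubini_G iPsi.
have GE : (fun w => (\int[lam]_(t in A) Phi (t, w))%:E) =
    (EFin \o fine) \o fubini_G lam (EFin \o Psi).
  by apply/funext => w; rewrite /= /fubini_G /Rintegral integral_mkcond -restrictE.
have mfG : measurable_fun setT (fun w => (\int[lam]_(t in A) Phi (t, w))%:E).
  by rewrite GE; apply/measurable_EFinP; exact: measurableT_comp mG.
apply/integrableP; split => //.
apply: le_lt_trans ((integrable21ltyP _ _ mPsi).1 iPsi).
apply: ge0_le_integral => //.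
- by apply: measurableT_comp.
- apply: (measurable_fun_fubini_tonelli_G (abse \o (EFin \o Psi))).
    exact: measurableT_comp.
  by move=> z /=; rewrite lee_fin.
- move=> w _; have mw : measurable_fun setT (fun t => (Psi (t, w))%:E).
    by apply: measurableT_comp mPsi _; exact: measurable_pair2.
  apply: le_trans (le_abse_integral lam measurableT mw).
  have -> : (\int[lam]_(t in A) Phi (t, w))%:E =
    (fine (fubini_G lam (EFin \o Psi) w))%:E := congr1 (@^~ w) GE.
  by rewrite /fubini_G /=; case: integral => [r| |] //=; rewrite ?leey.
Qed.

Lemma strip_fubini :
  \int[lam]_(t in A) \int[P]_w Phi (t, w) =
  \int[P]_w \int[lam]_(t in A) Phi (t, w).
Proof.
have := Fubini iPsi.
rewrite (ae_eq_integral_nomeas (g := fun w =>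
  (\int[lam]_(t in A) Phi (t, w))%:E)); last by apply: ae_imp fin2.
rewrite /Rintegral => <-; congr fine.
rewrite integral_mkcond; apply: ae_eq_integral_nomeas.
apply: ae_imp (strip_ae_integrable1) => t it _.
rewrite patchE; case: ifPn => tA.
  rewrite inE in tA; rewrite fineK; last exact: integrable_fin_num (it tA).
  by apply: eq_integral => w _; rewrite /Psi/= indicE mem_set// mul1r.
by apply/esym/integral0_eq => w _; rewrite /Psi/= indicE (negbTE tA) mul0r.
Qed.

End fubini_strip.

(** * The evaluation map *)

Section clamp.
Context {R : realType} (T : R) (T0 : 0 < T).

Definition clamp (t : R) : R := Num.max 0 (Num.min t T).

Lemma clamp_in t : 0 <= clamp t <= T.
Proof.
by rewrite /clamp le_max lexx/= ge_max (ltW T0)/= ge_min lexx orbT.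
Qed.

Lemma clampE t : 0 <= t <= T -> clamp t = t.
Proof. by move=> /andP[t0 tT]; rewrite /clamp min_l// max_r. Qed.

Lemma clamp_continuous : continuous clamp.
Proof.
move=> t; apply: (@continuous_max _ _ (cst 0) (fun s : R => Num.min s T) t).
  exact: cvg_cst.
by apply: (@continuous_min _ _ id (cst T) t); [exact: cvg_id|exact: cvg_cst].
Qed.

End clamp.

Section evaluation.
Context {R : realType} (T : R) (T0 : 0 < T) {X : completeMetricType R}.
Implicit Types (c : curve T X).

Lemma curve_clamp_continuous c : continuous (fun t => c (clamp T t)).
Proof.
move=> t; have cT : `[0, T]%classic (clamp T t) by rewrite /= in_itv/= clamp_in.
have cc := (subspace_continuousP _ _).1 (curve_continuous c) _ cT.
have ct : clamp T s @[s --> t] --> within `[0, T]%classic (nbhs (clamp T t)).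
  move=> B wB.
  apply: (@filterS _ (nbhs t) _ [set s | `[0, T]%classic (clamp T s) ->
    B (clamp T s)]); last exact: (@clamp_continuous _ T t _ wB).
  by move=> s; apply; rewrite /= in_itv/= clamp_in.
exact: (cvg_comp _ _ ct cc).
Qed.

(** Evaluation with the time moved into [[0, T]]: unlike [ev], it is continuous in
    [t] on the whole real line. *)
Definition evc (t : R) (c : borel (curve T X)) : borel X := ev (clamp T t) c.

Lemma evcE t c : 0 <= t <= T -> evc t c = ev t c.
Proof. by move=> tT; rewrite /evc clampE. Qed.

Lemma evc_measurable : measurable_fun setT
  (fun z : measurableTypeR R * borel (curve T X) => evc z.1 z.2).
Proof.
apply: (@measurable_caratheodory _ R (borel (curve T X)) X evc).
  by move=> c; exact: curve_clamp_continuous.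
by move=> t; exact: ev_measurable.
Qed.

End evaluation.

(** * Lipschitz functions and absolutely continuous marginals *)

Lemma metric_ball_open (R : realType) (X : metricType R) (x : X) (r : R) :
  open (ball x r).
Proof.
rewrite openE => y; rewrite ballEmdist/= => xy.
apply/nbhs_ballP; exists (r - mdist x y); first by rewrite /= subr_gt0.
move=> z; rewrite !ballEmdist/= => yz.
by rewrite (le_lt_trans (metric_triangle _ y _))// -ltrBrDl.
Qed.

Lemma lipschitz_continuous (R : realType) (X : metricType R) (f : X -> R) :
  lipschitz_fun f -> continuous f.
Proof.
move=> [L fL] x; apply/cvgrPdist_lt => e e0.
have L0 : 0 < `|L| + 1 by rewrite ltr_wpDl.
have /nbhs_ballP := nbhsx_ballx x (e / (`|L| + 1)) (divr_gt0 e0 L0).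
move=> [r r0 xr]; apply/nbhs_ballP; exists r => // y /xr; rewrite ballEmdist/=.
rewrite ltr_pdivlMr// => xy; apply: le_lt_trans (fL x y) _.
apply: le_lt_trans xy; rewrite mulrC ler_wpM2l ?mdist_ge0//.
by rewrite (le_trans (ler_norm _))// lerDl.
Qed.

Lemma continuous_borel_measurable (R : realType) (Y : ptopologicalType)
    (f : Y -> R) :
  continuous f -> measurable_fun setT (f : borel Y -> R).
Proof.
move=> cf; apply: (measurability _ (RGenOpens.measurableE R)).
move=> _ [_ [a [b ->] <-]]; rewrite setTI; apply: sub_sigma_algebra.
by apply: open_comp; [move=> x _; exact: cf|exact: interval_open].
Qed.

Section lipschitz_functions.
Context {R : realType} {X : metricType R}.
Implicit Types f : X -> R.

(** A Lipschitz function is bounded on a bounded support. *)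
Lemma Lip_bs_bounded f : Lip_bs f -> bounded_fun f.
Proof.
move=> [[L fL] [x [r fr]]].
exists (`|f x| + `|L| * `|r|); split; first exact: num_real.
move=> M ltM y _; apply: le_trans (ltW ltM).
have [fy0|fy0] := eqVneq (f y) 0.
  by rewrite fy0 normr0 addr_ge0// mulr_ge0.
have : ball x r y by apply: fr; apply: subset_closure.
rewrite ballEmdist/= => xyr.
have -> : f y = f x + - (f x - f y) by ring.
rewrite (le_trans (ler_normD _ _))// lerD2l normrN (le_trans (fL x y))//.
rewrite (le_trans (ler_norm _))// normrM ler_wpM2l//.
by rewrite ger0_norm ?mdist_ge0// (le_trans (ltW xyr))// ler_norm.
Qed.

Lemma Lip_bs_Lip_b f : Lip_bs f -> Lip_b f.
Proof. by move=> Lf; split; [case: Lf|exact: Lip_bs_bounded]. Qed.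

End lipschitz_functions.

Section sigma_finite_metric_measure.
Context {R : realType} {X : completeMetricType R}.
Context (m : {measure set (borel X) -> \bar R}) (hm : metric_measure_space m).

Lemma metric_measure_space_sigma_finite : sigma_finite [set: borel X] m.
Proof.
have [_ mfin] := hm.
exists (fun n => ball (point : X) n.+1%:R).
  apply/esym; rewrite -subTset => x _.
  exists (Num.bound (mdist point x)) => //=; rewrite ballEmdist/=.
  rewrite (lt_le_trans (archi_boundP (mdist_ge0 _ _)))//.
  by rewrite ler_nat.
move=> n; have mb : measurable (ball (point : X) n.+1%:R : set (borel X)).
  by apply: sub_sigma_algebra; exact: metric_ball_open.
by split => //; apply: mfin => //; exists point, n.+1%:R.
Qed.

(** A copy of [m] that carries a proof of sigma-finiteness, from which the measure
    structure is inferred. *)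
Definition sigma_finite_mms of metric_measure_space m : set (borel X) -> \bar R :=
  m.

HB.instance Definition _ := Measure.on (sigma_finite_mms hm).

HB.instance Definition _ := Measure_isSigmaFinite.Build _ _ _
  (sigma_finite_mms hm) metric_measure_space_sigma_finite.

End sigma_finite_metric_measure.

Section transport.
Context {R : realType} (T : R) (T0 : 0 < T) {X : completeMetricType R}.
Context (m : {measure set (borel X) -> \bar R}) (hm : metric_measure_space m).
Context (P : probability (borel (curve T X)) R).
Notation lam := (@lebesgue_measure R).

Hypothesis P_abs : \forall t \ae lam,
  `]0, T[%classic t -> distribution P (ev t) `<< m.

Variable Q : measurableTypeR R * borel X -> Prop.
Hypothesis aeQ : \forall z \ae (lam \x m)%E, `]0, T[%classic z.1 -> Q z.

Let mI : measurable (`]0, T[%classic : set (measurableTypeR R)).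
Proof. exact: measurable_itv. Qed.

(** A null set of [dt * m] has null sections at almost every time, for [m] and
    hence for the marginal of [P]. *)
Let null_section : exists2 N : set (measurableTypeR R * borel X), measurable N &
  [/\ forall z, `]0, T[%classic z.1 -> ~ Q z -> N z &
    \forall t \ae lam, `]0, T[%classic t ->
       distribution P (ev t) (xsection N t) = 0%E].
Proof.
have [N [mN N0 QN]] := aeQ.
exists N => //; split.
  by move=> z zT nQz; apply: QN => /= /(_ zT).
have := (@product_null_xsection _ _ _ _ _ lam (sigma_finite_mms hm) N mN).1 N0.
apply: ae_imp2 P_abs => t abs_t N0t tT.
have /null_content_dominatesP := abs_t tT; apply => //.
exact: measurable_xsection.
Qed.

Lemma ae_along_marginal : \forall t \ae lam, `]0, T[%classic t ->
  \forall x \ae distribution P (ev t), Q (t, x).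
Proof.
have [N mN [QN N0]] := null_section.
apply: ae_imp N0 => t N0t tT; exists (xsection N t); split.
- exact: measurable_xsection.
- exact: N0t.
- by move=> x /= nQ; rewrite /xsection/= inE; exact: QN.
Qed.

(** The law of [(t, gamma t)] under [dt * P] is absolutely continuous with
    respect to [dt * m]. *)
Lemma ae_along_curves : \forall z \ae (lam \x P)%E,
  `]0, T[%classic z.1 -> Q (z.1, ev z.1 z.2).
Proof.
have [N mN [QN N0]] := null_section.
pose G (z : measurableTypeR R * borel (curve T X)) :=
  (z.1, evc z.1 z.2) : measurableTypeR R * borel X.
have mG : measurable_fun setT G.
  by apply/measurable_fun_pairP; split; [exact: measurable_fst|exact: evc_measurable].
pose N' := (`]0, T[%classic `*` setT) `&` G @^-1` N.
have mN' : measurable N'.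
  apply: measurableI; first exact: measurableX.
  by rewrite -[X in measurable X]setTI; exact: mG.
exists N'; split => //.
  apply/product_null_xsection => //; apply: ae_imp N0 => t N0t.
  have [tT|ntT] := pselect (`]0, T[%classic t); last first.
    rewrite (_ : xsection N' t = set0) ?measure0// -subset0 => c.
    by rewrite /xsection/= inE => -[[]].
  have tT' : 0 <= t <= T.
    by move: tT; rewrite /= in_itv/= => /andP[t0 t1]; rewrite !ltW.
  rewrite -(N0t tT); congr (P _); apply/seteqP; split => c;
    rewrite /xsection/= !inE /N' /G/= (evcE _ tT'); first by case.
  by move=> Nc; split.
move=> [t c] /= /not_implyP[tT nQ]; split => //=.
rewrite /G/= evcE; first exact: QN.
by move: tT; rewrite /= in_itv/= => /andP[t0 t1]; rewrite !ltW.
Qed.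

End transport.

(** * The continuity equation along a measure on curves *)

Section continuity_equation_on_curves.
Context {R : realType} (T : R) (T0 : 0 < T) {X : completeMetricType R}.
Context (m : {measure set (borel X) -> \bar R}) (hm : metric_measure_space m).
Context (b : R -> (X -> R) -> X -> R) (f : X -> R) (Lf : Lip_bs f).
Context (B : measurableTypeR R * borel X -> R) (mB : measurable_fun setT B).
Context (P : probability (borel (curve T X)) R).
Notation lam := (@lebesgue_measure R).
Notation timeI := (`]0, T[%classic : set (measurableTypeR R)).

Hypothesis bB : \forall z \ae (lam \x m)%E,
  `]0, T[%classic z.1 -> b z.1 f z.2 = B z.
Hypothesis P_abs : \forall t \ae lam,
  `]0, T[%classic t -> distribution P (ev t) `<< m.

Let mI : measurable timeI.
Proof. exact: measurable_itv. Qed.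

Definition obs (c : borel (curve T X)) (t : R) : R := f (evc t c).
Definition vel (c : borel (curve T X)) (t : R) : R := B (t, evc t c).

Lemma measurable_obs : measurable_fun setT
  (fun z : measurableTypeR R * borel (curve T X) => obs z.2 z.1).
Proof.
apply: (measurableT_comp (f := f : borel X -> R)); last exact: evc_measurable.
by apply: continuous_borel_measurable; apply: lipschitz_continuous; case: Lf.
Qed.

Lemma measurable_vel : measurable_fun setT
  (fun z : measurableTypeR R * borel (curve T X) => vel z.2 z.1).
Proof.
apply: (measurableT_comp mB); apply/measurable_fun_pairP.
by split; [exact: measurable_fst|exact: evc_measurable].
Qed.

Lemma obs_bounded : exists M, forall c t, `|obs c t| <= M.
Proof.
have [M [_ hM]] := Lip_bs_bounded Lf.
by exists (M + 1) => c t; apply: (hM (M + 1)); rewrite ?ltrDl.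
Qed.

Lemma measurable_obs_pair1 t : measurable_fun setT (obs^~ t).
Proof. exact: (measurableT_comp measurable_obs (measurable_pair1 t)). Qed.

Lemma integrable_obs t : P.-integrable setT (EFin \o obs^~ t).
Proof.
have [M hM] := obs_bounded.
apply: measurable_bounded_integrable => //.
- by rewrite /= probability_setT ltry.
- exact: measurable_obs_pair1.
- by exists M; split; [exact: num_real|move=> N MN c _; exact: le_trans (hM _ _) (ltW MN)].
Qed.

Lemma integral_obs t : 0 <= t <= T ->
  \int[distribution P (ev t)]_x f x = \int[P]_c obs c t.
Proof.
move=> tT; rewrite /Rintegral integral_distribution//.
- by congr fine; apply: eq_integral => c _; rewrite /obs (evcE _ tT).
- apply/measurable_EFinP.
  by apply: continuous_borel_measurable; apply: lipschitz_continuous; case: Lf.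
- apply: eq_integrable (integrable_obs t) => // c _.
  by rewrite /= /obs (evcE _ tT).
Qed.

Let I_in t : timeI t -> 0 <= t <= T.
Proof. by rewrite /= in_itv/= => /andP[t0 t1]; rewrite !ltW. Qed.

Lemma integral_norm_vel :
  (\int[lam]_(t in timeI) \int[distribution P (ev t)]_x `|b t f x|%:E =
   \int[lam]_(t in timeI) \int[P]_c `|vel c t|%:E)%E.
Proof.
apply: ae_eq_integral_nomeas.
apply: ae_imp (ae_along_marginal hm P_abs bB) => t bBt It.
rewrite (ae_eq_integral_nomeas (g := fun x => `|B (t, x)|%:E)); last first.
  by apply: ae_imp (bBt It) => x /= -> _.
rewrite ge0_integral_distribution//.
- by apply: eq_integral => c _; rewrite /vel (evcE _ (I_in It)).
- apply/measurable_EFinP; apply: measurableT_comp => //.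
  exact: (measurableT_comp mB (measurable_pair1 t)).
Qed.

Hypothesis vel_summable :
  (\int[lam]_(t in timeI) \int[P]_c `|vel c t|%:E < +oo)%E.

Lemma integrable_vel : (lam \x P)%E.-integrable (timeI `*` setT)
  (EFin \o (fun z => vel z.2 z.1)).
Proof. exact: (strip_integrableP mI measurable_vel vel_summable). Qed.

Lemma integral_vel : \forall t \ae lam, timeI t ->
  P.-integrable setT (EFin \o vel^~ t) /\
  \int[distribution P (ev t)]_x b t f x = \int[P]_c vel c t.
Proof.
have iv := strip_ae_integrable1 mI integrable_vel.
apply: (ae_imp2 _ (ae_along_marginal hm P_abs bB) iv) => t bBt ivt It.
have it := ivt It; split; first exact: it.
rewrite (ae_eq_Rintegral (g := fun x => B (t, x))); last first.
  by apply: ae_imp (bBt It) => x /= -> _.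
rewrite /Rintegral integral_distribution//.
- by congr fine; apply: eq_integral => c _; rewrite /vel (evcE _ (I_in It)).
- by apply/measurable_EFinP; exact: (measurableT_comp mB (measurable_pair1 t)).
- apply: eq_integrable it => // c _.
  by rewrite /= /vel (evcE _ (I_in It)).
Qed.

Section test_function.
Variables (chi : R -> R) (Cchi : C1_c T chi).

Let cchi : continuous chi.
Proof.
have [dchi _ _] := Cchi => x.
by apply: differentiable_continuous; exact/derivable1_diffP.
Qed.

Let mchi : measurable_fun setT
  (fun z : measurableTypeR R * borel (curve T X) => chi z.1).
Proof.
apply: (measurableT_comp (f := chi : measurableTypeR R -> R)) => //.
exact: continuous_measurable_fun.
Qed.

Let mdchi : measurable_fun setT
  (fun z : measurableTypeR R * borel (curve T X) => derive1 chi z.1).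
Proof.
apply: (measurableT_comp (f := derive1 chi : measurableTypeR R -> R)) => //.
by apply: continuous_measurable_fun; have [_ + _] := Cchi.
Qed.

Let mIT : measurable (timeI `*` [set: borel (curve T X)]).
Proof. exact: measurableX. Qed.

Let i_dchi_obs : (lam \x P)%E.-integrable (timeI `*` setT)
  (EFin \o (fun z => derive1 chi z.1 * obs z.2 z.1)).
Proof.
have [_ cdchi _] := Cchi.
have [M1 hM1] := continuous_within_bounded
  (continuous_subspaceT cdchi : {within `[0, T], continuous (derive1 chi)}).
have [M2 hM2] := obs_bounded.
apply: measurable_bounded_integrable => //.
- rewrite /= product_measure1E//= probability_setT mule1 lebesgue_measure_itv/=.
  by rewrite lte_fin T0 -EFinB ltry.
- by apply: measurable_funTS; apply: measurable_funM => //; exact: measurable_obs.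
- exists (M1 * M2); split; first exact: num_real.
  move=> N MN [t c] [/= It _]; apply: le_trans (ltW MN).
  have /andP[t0 t1] := I_in It.
  by rewrite normrM ler_pM//; exact: hM1.
Qed.

Let i_chi_vel : (lam \x P)%E.-integrable (timeI `*` setT)
  (EFin \o (fun z => chi z.1 * vel z.2 z.1)).
Proof.
have [M hM] := continuous_within_bounded
  (continuous_subspaceT cchi : {within `[0, T], continuous chi}).
apply: (@integrable_bounded_mulr _ _ _ _ _ mIT (fun z => chi z.1)
  (fun z => vel z.2 z.1) M).
- exact: measurable_funTS.
- by move=> [t c] [/= It _]; have /andP[t0 t1] := I_in It; exact: hM.
- exact: integrable_vel.
Qed.

Let mco : measurable_fun setT (fun z : measurableTypeR R * borel (curve T X) =>
  derive1 chi z.1 * obs z.2 z.1).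
Proof. by apply: measurable_funM => //; exact: measurable_obs. Qed.

Let mcv : measurable_fun setT (fun z : measurableTypeR R * borel (curve T X) =>
  chi z.1 * vel z.2 z.1).
Proof. by apply: measurable_funM => //; exact: measurable_vel. Qed.

Lemma ae_vel_integrable :
  \forall c \ae P, lam.-integrable timeI (EFin \o vel c).
Proof. exact: (strip_ae_integrable2 mI integrable_vel). Qed.

Let weak_pairingE : \forall c \ae P, weak_pairing T (obs c) (vel c) chi =
  \int[lam]_(t in timeI) (derive1 chi t * obs c t) +
  \int[lam]_(t in timeI) (chi t * vel c t).
Proof.
apply: (ae_imp2 _ (strip_ae_integrable2 mI i_dchi_obs)
  (strip_ae_integrable2 mI i_chi_vel)) => c i1 i2.
by rewrite /weak_pairing RintegralD.
Qed.

Lemma integrable_weak_pairing :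
  P.-integrable setT (EFin \o (fun c => weak_pairing T (obs c) (vel c) chi)).
Proof.
have mcw : measurable_fun setT
    (fun z : measurableTypeR R * borel (curve T X) =>
      derive1 chi z.1 * obs z.2 z.1 + chi z.1 * vel z.2 z.1).
  exact: measurable_funD.
exact: (strip_integrable mI mcw (integrable_addr mIT i_dchi_obs i_chi_vel)).
Qed.

(** Fubini's theorem exchanges [dt] and [P] on both sides of the equation. *)
Lemma continuity_equationE :
  (- (\int[lam]_(t in `]0, T[)
       (derive1 chi t * (\int[distribution P (ev t)]_x f x))) =
   (\int[lam]_(t in `]0, T[)
       (chi t * (\int[distribution P (ev t)]_x b t f x))) +
    chi 0 * (\int[distribution P (ev 0)]_x f x)) <->
  \int[P]_c weak_pairing T (obs c) (vel c) chi =
  - (chi 0 * \int[P]_c obs c 0).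
Proof.
rewrite (integral_obs (t := 0)) ?lexx ?ltW//.
have -> : \int[lam]_(t in `]0, T[)
    (derive1 chi t * (\int[distribution P (ev t)]_x f x)) =
    \int[P]_c \int[lam]_(t in timeI) (derive1 chi t * obs c t).
  rewrite -(strip_fubini mI i_dchi_obs); apply: eq_Rintegral => t.
  rewrite inE => It; rewrite (integral_obs (I_in It))/= RintegralZl//.
  exact: integrable_obs.
have -> : \int[lam]_(t in `]0, T[)
    (chi t * (\int[distribution P (ev t)]_x b t f x)) =
    \int[P]_c \int[lam]_(t in timeI) (chi t * vel c t).
  rewrite -(strip_fubini mI i_chi_vel); apply: ae_eq_Rintegral.
  apply: ae_imp integral_vel => t + It => /(_ It)[ivt ->].
  by rewrite /= RintegralZl.
rewrite (ae_eq_Rintegral (f := fun c => weak_pairing T (obs c) (vel c) chi)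
  (g := fun c => \int[lam]_(t in timeI) (derive1 chi t * obs c t) +
  \int[lam]_(t in timeI) (chi t * vel c t))); last first.
  by apply: ae_imp weak_pairingE => c.
rewrite RintegralD//; last 2 first.
- exact: (strip_integrable mI mco i_dchi_obs).
- exact: (strip_integrable mI mcv i_chi_vel).
by split; lra.
Qed.

End test_function.

End continuity_equation_on_curves.

(** * Measures with a density, and duality with continuous functions *)

Section density.
Local Open Scope ereal_scope.
Context d (Y : measurableType d) (R : realType) (mu : {measure set Y -> \bar R}).
Context (g : Y -> R) (mg : measurable_fun setT g) (g0 : forall x, (0 <= g x)%R).

(** The proofs are arguments so that the measure structure can be inferred. *)
Definition density of measurable_fun setT g & (forall x, (0 <= g x)%R) :
  set Y -> \bar R := fun A => \int[mu]_(x in A) (g x)%:E.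

Let density0 : density mg g0 set0 = 0.
Proof. by rewrite /density integral_set0. Qed.

Let density_ge0 A : 0 <= density mg g0 A.
Proof. by apply: integral_ge0 => x _; rewrite lee_fin. Qed.

Let density_sigma_additive : semi_sigma_additive (density mg g0).
Proof.
move=> F mF tF mUF; rewrite /density; apply: cvg_toP.
  apply: ereal_nondecreasing_is_cvgn => m n mn.
  apply: lee_sum_nneg_natr => // k _ _.
  by apply: integral_ge0 => x _; rewrite lee_fin.
rewrite ge0_integral_bigcup//=.
- by apply/measurable_funTS/measurable_EFinP.
- by move=> x _; rewrite lee_fin.
Qed.

HB.instance Definition _ := isMeasure.Build _ _ _ (density mg g0)
  density0 density_ge0 density_sigma_additive.

Hypothesis g1 : \int[mu]_x (g x)%:E = 1.

Definition density_probability of \int[mu]_x (g x)%:E = 1 : set Y -> \bar R :=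
  density mg g0.

HB.instance Definition _ := Measure.on (density_probability g1).

Let density_setT : density_probability g1 [set: Y] = 1.
Proof. exact: g1. Qed.

HB.instance Definition _ := @Measure_isProbability.Build _ _ _
  (density_probability g1) density_setT.

End density.

Section change_of_measure.
Context d (Y : measurableType d) (R : realType).
Context (mu nu : probability Y R) (g : Y -> R).
Hypothesis mg : measurable_fun setT g.
Hypothesis nuE : forall A, measurable A -> nu A = (\int[mu]_(x in A) (g x)%:E)%E.

Lemma density_dominates : nu `<< mu.
Proof.
apply/null_content_dominatesP => A mA A0; rewrite nuE//.
rewrite null_set_integral//; last exact/measurable_funTS/measurable_EFinP.
Qed.

(** [g] is the Radon-Nikodym derivative of [nu]. *)
Lemma integral_density (f : Y -> R) : nu.-integrable setT (EFin \o f) ->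
  (\int[nu]_x (f x)%:E = \int[mu]_x (f x * g x)%:E)%E.
Proof.
move=> nuf; rewrite -(Radon_Nikodym_change_of_variables density_dominates)//.
apply: ae_eq_integral_nomeas.
have RNg : ae_eq mu setT (Radon_Nikodym (charge_of_finite_measure nu) mu) (EFin \o g).
  apply: integral_ae_eq => //.
  - by apply: Radon_Nikodym_integrable; exact: density_dominates.
  - exact/measurable_EFinP.
  - move=> A _ mA; rewrite -Radon_Nikodym_integral//; last exact: density_dominates.
    exact: nuE.
by apply: ae_imp RNg => x /(_ I) -> _; rewrite EFinM.
Qed.

End change_of_measure.

Section open_cutoff.
Context {R : realType} {Y : metricType R} (U : set Y).
Implicit Types x y : Y.

(** The distance to the complement of [U], truncated at 1. *)
Definition depth x : R := sup [set r | 0 <= r <= 1 /\ ball x r `<=` U].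

Let ball0 x : ball x (0 : R) `<=` U.
Proof. by move=> y; rewrite ballEmdist/= ltNge mdist_ge0. Qed.

Let depth_ub x : has_ubound [set r | 0 <= r <= 1 /\ ball x r `<=` U].
Proof. by exists 1 => r /= [/andP[]]. Qed.

Let depth_le x r : 0 <= r <= 1 -> ball x r `<=` U -> r <= depth x.
Proof. by move=> r01 xr; apply: ub_le_sup. Qed.

Lemma depth_ge0 x : 0 <= depth x.
Proof. by apply: depth_le => //; rewrite lexx ler01. Qed.

Lemma depth_gt0 x : open U -> U x -> 0 < depth x.
Proof.
move=> oU Ux; have /nbhs_ballP[r /= r0 xr] : nbhs x U by apply: open_nbhs_nbhs.
apply: (@lt_le_trans _ _ (Num.min r 1)); first by rewrite lt_min r0 ltr01.
apply: depth_le; first by rewrite ge_min lexx orbT andbT le_min ltW/=.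
by apply: subset_trans xr; apply: le_ball; rewrite ge_min lexx.
Qed.

Lemma depth_out x : ~ U x -> depth x = 0.
Proof.
move=> nUx; apply/eqP; rewrite eq_le depth_ge0 andbT.
apply: ge_sup; first by exists 0; split; [rewrite lexx ler01|exact: ball0].
move=> r /= [_ xr]; rewrite leNgt; apply/negP => r0; apply: nUx; apply: xr.
exact: ballxx.
Qed.

Lemma depth_continuous : continuous depth.
Proof.
apply: lipschitz_continuous; exists 1 => x y; rewrite mul1r.
have half (u v : Y) : depth u <= depth v + mdist u v.
  apply: ge_sup; first by exists 0; split; [rewrite lexx ler01|exact: ball0].
  move=> r /= [/andP[r0 r1] ur].
  have [rd|dr] := leP r (mdist u v); first by rewrite (le_trans rd)// lerDr depth_ge0.
  rewrite -lerBlDr; apply: depth_le.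
    rewrite subr_ge0 (ltW dr)/= (le_trans _ r1)// gerBl mdist_ge0//.
  move=> z; rewrite ballEmdist/= => vz; apply: ur; rewrite ballEmdist/=.
  by rewrite (le_lt_trans (metric_triangle _ v _))// -ltrBrDl.
have := half x y; have := half y x; rewrite (metric_sym y x) ler_norml.
by move=> h1 h2; apply/andP; split; lra.
Qed.

Definition open_cutoff (n : nat) x : R := Num.min 1 (n%:R * depth x).

Lemma open_cutoff_continuous n : continuous (open_cutoff n).
Proof.
move=> x; apply: (@continuous_min _ _ (cst 1) (fun y => n%:R * depth y) x).
  exact: cvg_cst.
by apply: cvgMr; exact: depth_continuous.
Qed.

Lemma open_cutoff_itv n x : 0 <= open_cutoff n x <= 1.
Proof. by rewrite le_min ler01 mulr_ge0 ?depth_ge0//= ge_min lexx. Qed.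

Lemma open_cutoff_cvg x : open U -> open_cutoff n x @[n --> \oo] --> (\1_U x : R).
Proof.
move=> oU; rewrite indicE; have [|] := boolP (x \in U).
  rewrite inE => Ux; have d0 := depth_gt0 oU Ux.
  apply: cvg_near_cst; exists (Num.bound (depth x)^-1) => // n /= dn.
  rewrite /open_cutoff min_l// -(ler_pdivrMr _ _ d0) div1r.
  apply: ltW; apply: lt_le_trans (archi_boundP _) _; last by rewrite ler_nat.
  by rewrite invr_ge0 ltW.
rewrite notin_setE => Ux.
by apply: cvg_near_cst; apply: nearW => n; rewrite /open_cutoff depth_out// mulr0 min_r// ler01.
Qed.

End open_cutoff.

(** The indicator of an open set is a bounded limit of continuous functions, so the
    integrals of [Psi] over open sets vanish by dominated convergence; Dynkin's
    theorem extends this to Borel sets. *)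
Lemma ae_eq0_of_continuous_duality (R : realType) (Y : ptopologicalType)
    (P : probability (borel Y) R) (Psi : Y -> R) :
  (forall U : set Y, open U -> exists u : nat -> Y -> R,
    [/\ forall n, continuous (u n), forall n x, 0 <= u n x <= 1 &
      forall x, u n x @[n --> \oo] --> (\1_U x : R)]) ->
  P.-integrable setT (EFin \o (Psi : borel Y -> R)) ->
  (forall g : Y -> R, continuous g -> (forall x, 0 <= g x <= 1) ->
    (\int[P]_x (Psi x * g x)%:E)%E = 0%E) ->
  \forall x \ae P, Psi x = 0.
Proof.
move=> open_approx iPsi Psi0.
have mPsi : measurable_fun setT (EFin \o (Psi : borel Y -> R)).
  exact: measurable_int iPsi.
have open0 (U : set (borel Y)) : open U -> (\int[P]_(x in U) (Psi x)%:E)%E = 0%E.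
  move=> oU; have mU : measurable U by exact: sub_sigma_algebra.
  have [u [cu u01 uU]] := open_approx U oU.
  have mu n : measurable_fun setT (u n : borel Y -> R).
    exact: continuous_borel_measurable.
  have mf n : measurable_fun setT
      (fun x : borel Y => (Psi x * u n x)%:E).
    by apply/measurable_EFinP; apply: measurable_funM => //; exact/measurable_EFinP.
  have mf' : measurable_fun setT (fun x : borel Y => (Psi x * \1_U x)%:E).
    apply/measurable_EFinP; apply: measurable_funM; first exact/measurable_EFinP.
    exact: measurable_indic.
  have cvf : \forall x \ae P, setT x ->
      (Psi x * u n x)%:E @[n --> \oo] --> (Psi x * \1_U x)%:E.
    apply: aeW => x _; apply: cvg_EFin; first exact: nearW.
    by apply: cvgMr; exact: uU.
  have domf : \forall x \ae P, forall n, setT x ->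
      (`|(Psi x * u n x)%:E| <= (abse \o (EFin \o Psi)) x)%E.
    apply: aeW => x n _; rewrite /= lee_fin normrM ler_piMr//.
    by have /andP[g0 g1] := u01 n x; rewrite ger0_norm.
  have [_ _] := dominated_convergence measurableT mf mf' cvf
    (integrable_abse iPsi) domf.
  rewrite (_ : (fun _ => _) = cst 0%E); last first.
    apply/funext => n; apply: Psi0; first exact: cu.
    exact: u01.
  move=> /cvg_lim => /(_ (@ereal_hausdorff R)); rewrite lim_cst// => E0.
  rewrite integral_mkcond [RHS]E0; apply: eq_integral => x _.
  by rewrite patchE indicE; case: ifPn => _; rewrite ?mulr1 ?mulr0.
have all0 (E : set (borel Y)) : measurable E ->
    (\int[P]_(x in E) (Psi x)%:E)%E = 0%E.
  have iPsiE (A : set (borel Y)) : measurable A ->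
      P.-integrable A (EFin \o (Psi : borel Y -> R)).
    by move=> mA; apply: integrableS iPsi.
  apply: (@dynkin_induction _ (borel Y) (@open Y) (fun E : set (borel Y) =>
    (\int[P]_(x in E) (Psi x)%:E)%E = 0%E) erefl) => //.
  - by move=> A B; exact: openI.
  - by apply: open0; exact: openT.
  - move=> S mS S0.
    have := open0 setT openT; rewrite -(setUv S) integral_setU//.
    + by rewrite S0 add0e.
    + exact: measurableC.
    + by rewrite setUv.
    + by rewrite disj_set2E setICr.
  - move=> F mF tF F0; rewrite integral_bigcup//; first exact: eseries0.
    by apply: iPsiE; exact: bigcupT_measurable.
have H : ae_eq P setT (EFin \o Psi) (cst 0%E).
  apply: integral_ae_eq => // E _ mE.
  by rewrite integral_cst// mul0e; exact: all0.
by apply: ae_imp H => x /(_ I) [].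
Qed.

(** * Measurability of the set of differentiability *)

(** By continuity, a bound on difference quotients extends from rational to real
    increments; the rational form is what makes the set below measurable. *)
Lemma is_derive_ratP (R : realType) (F : R -> R) (t d : R) : continuous F ->
  is_derive t (1 : R) F d <->
  forall k, exists n, forall q : rat, q != 0 -> `|ratr q : R| < n.+1%:R^-1 ->
    `|F (t + ratr q) - F t - ratr q * d| <= `|ratr q| * k.+1%:R^-1.
Proof.
move=> cF; split=> [[dF dFE] k|H].
  have /cvgrPdist_le/(_ k.+1%:R^-1) : (r^-1 *: ((F \o shift t) (r *: (1 : R)) - F t))
      @[r --> 0^'] --> d by rewrite -dFE; exact: dF.
  rewrite invr_gt0 ltr0n => /(_ isT)/nbhs_ballP[e /= e0 He].
  have [n _ /(_ n (leqnn n)) /= ne] := near_infty_natSinv_lt (PosNum e0).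
  exists n => q q0 qn.
  have q0' : ratr q != 0 :> R by rewrite fmorph_eq0.
  have := He (ratr q); rewrite /ball/= sub0r normrN => /(_ (lt_trans qn ne) q0').
  rewrite /GRing.scale/= mulr1 addrC (addrC _ t) => Hq.
  have -> : F (t + ratr q) - F t - ratr q * d =
      ratr q * - (d - (ratr q)^-1 * (F (t + ratr q) - F t)).
    by rewrite opprB mulrBr mulrA divff// mul1r.
  by rewrite normrM normrN ler_wpM2l// addrC.
have cvd : (r^-1 *: ((F \o shift t) (r *: (1 : R)) - F t)) @[r --> 0^'] --> d.
  apply/cvgrPdist_le => e e0.
  have [k _ /(_ k (leqnn k)) /= ke] := near_infty_natSinv_lt (PosNum e0).
  have [n Hn] := H k.
  have n0 : 0 < n.+1%:R^-1 :> R by rewrite invr_gt0.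
  apply/nbhs_ballP; exists n.+1%:R^-1 => //= r.
  rewrite /ball/= sub0r normrN => rn r0.
  have key : `|F (t + r) - F t - r * d| <= `|r| * k.+1%:R^-1.
    rewrite leNgt; apply/negP => lt_r.
    pose phi s := `|F (t + s) - F t - s * d| - `|s| * k.+1%:R^-1.
    have phi0 : 0 < phi r by rewrite subr_gt0.
    have cphi : {for r, continuous phi}.
      apply: cvgB.
        apply: cvg_norm; apply: cvgB.
          apply: cvgB; last exact: cvg_cst.
          apply: (cvg_comp (fun s => t + s) F); last exact: cF.
          by apply: cvgD; [exact: cvg_cst|exact: cvg_id].
        by apply: cvgMl; exact: cvg_id.
      by apply: cvgMl; apply: cvg_norm; exact: cvg_id.
    have : \forall s \near r, [/\ 0 < phi s, `|s| < n.+1%:R^-1 & s != 0].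
      near=> s; split.
      - by near: s; apply: (cvgr_gt _ cphi).
      - near: s; apply: (cvgr_lt `|r|) => //.
        by apply: cvg_norm; exact: cvg_id.
      - near: s; apply: (cvgr_neq0 _ _ r0) => //.
    move=> /nbhs_ballP[e' /= e'0 He'].
    have [|q] := @rat_in_itvoo R r (r + e'); first by rewrite ltrDl.
    rewrite in_itv/= => /andP[rq qr].
    have [] := He' (ratr q).
      by rewrite /ball/= ltr_norml; apply/andP; split; lra.
    move=> phiq qn q0.
    have := Hn q _ qn; rewrite -(fmorph_eq0 (@ratr R)) => /(_ q0).
    by rewrite leNgt -subr_gt0 phiq.
  have -> : d - r^-1 *: ((F \o shift t) (r *: (1 : R)) - F t) =
      - (r^-1 * (F (t + r) - F t - r * d)).
    by rewrite /GRing.scale/= mulr1 (addrC r); field.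
  rewrite normrN normrM normfV ler_pdivrMl ?normr_gt0//.
  by rewrite (le_trans key)// ler_wpM2l// ltW.
by split; [apply/cvg_ex; exists d|apply/cvg_lim].
Unshelve. all: by end_near. Qed.

Lemma measurable_not_is_derive (R : realType) d (W : measurableType d)
    (F v : measurableTypeR R * W -> R) :
  (forall w, continuous (fun t : R => F (t, w))) ->
  measurable_fun setT F -> measurable_fun setT v ->
  measurable [set z : measurableTypeR R * W |
    ~ is_derive (z.1 : R) (1 : R) (fun t : R => F (t, z.2)) (v z)].
Proof.
move=> cF mF mv.
pose G (q : rat) (z : measurableTypeR R * W) : R :=
  `|F (z.1 + ratr q, z.2) - F z - ratr q * v z|.
have mG q : measurable_fun setT (G q).
  apply: measurableT_comp => //; apply: measurable_funB; last first.
    by apply: measurable_funM.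
  apply: measurable_funB => //; apply: measurableT_comp mF _.
  apply/measurable_fun_pairP; split; last exact: measurable_snd.
  by apply: measurable_funD => //; exact: measurable_fst.
have -> : [set z : measurableTypeR R * W |
    ~ is_derive (z.1 : R) (1 : R) (fun t : R => F (t, z.2)) (v z)] =
  \bigcup_k \bigcap_n \bigcup_(q : rat)
    (if (q != 0) && (`|ratr q : R| < n.+1%:R^-1)
     then G q @^-1` `]`|ratr q| * k.+1%:R^-1, +oo[ else set0).
  apply/seteqP; split => [[t w]|[t w]] /=; rewrite is_derive_ratP//.
    move=> /existsNP[k /forallNP Hk]; exists k => // n _.
    have /existsNP[q /not_implyP[q0 /not_implyP[qn /negP]]] := Hk n.
    rewrite -ltNge => Hq; exists q => //; rewrite q0 qn/=.
    by rewrite in_itv/= andbT.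
  move=> [k _ Hk] /(_ k)[n Hn].
  have [q _] := Hk n I; case: ifP => // /andP[q0 qn].
  rewrite /= in_itv/= andbT ltNge => /negP; apply; exact: Hn.
apply: bigcupT_measurable => k; apply: bigcapT_measurable => n.
apply: bigcupT_measurable_rat => q; case: ifP => // _.
by rewrite -[X in measurable X]setTI; exact: mG.
Qed.

(** * Curves and reweighted measures *)

Section curves.
Context {R : realType} (T : R) (T0 : 0 < T) {X : completeMetricType R}.
Context (f : X -> R) (Lf : Lip_bs f).
Notation lam := (@lebesgue_measure R).
Notation timeI := (`]0, T[%classic : set (measurableTypeR R)).

Lemma obs_continuous (c : borel (curve T X)) : continuous (obs f c).
Proof.
move=> t; apply: (cvg_comp (fun s => (c : curve T X) (clamp T s)) f).
  exact: curve_clamp_continuous.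
by apply: lipschitz_continuous; case: Lf.
Qed.

Lemma near_obsE (c : borel (curve T X)) (t : R) : timeI t ->
  \forall s \near t, obs f c s = f (ev s c).
Proof.
rewrite /= in_itv/= => /andP[t0 tT]; near=> s; rewrite /obs evcE//.
by apply/andP; split; apply/ltW; near: s; [exact: lt_nbhsr|exact: lt_nbhsl].
Unshelve. all: by end_near. Qed.

Lemma is_derive_obsE (c : borel (curve T X)) (t d : R) : timeI t ->
  is_derive t (1 : R) (obs f c) d <->
  is_derive t (1 : R) (fun s : R => f (ev s c) : R) d.
Proof.
move=> /(near_obsE c) cE; split; first exact: near_eq_is_derive.
by apply: near_eq_is_derive; apply: filterS cE => s ->.
Qed.

(** A Lipschitz function of an absolutely continuous curve is absolutely
    continuous, so it can be integrated by parts. *)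
Lemma weak_pairing_of_is_derive (c : borel (curve T X)) (w chi : R -> R) :
  abs_continuous_curve (c : curve T X) ->
  lam.-integrable timeI (EFin \o w) ->
  (\forall t \ae lam, timeI t -> is_derive t (1 : R) (obs f c) (w t)) ->
  C1_c T chi ->
  weak_pairing T (obs f c) w chi = - (chi 0 * obs f c 0).
Proof.
move=> [v iv cv] iw dc [dchi cdchi [s sT chis]].
have [[L fL] _] := Lf.
have mI : measurable timeI by exact: measurable_itv.
apply: (@weak_derivative _ _ T0 (obs f c) (fun r => `|L| * v r) w chi _ iw _ _
  dc dchi cdchi).
- exact: integrable_scaler.
- exact/continuous_subspaceT/obs_continuous.
- move=> r t r0 rt tT; rewrite /obs !evcE; last 2 first.
    by rewrite r0 (le_trans rt).
    by rewrite tT (le_trans r0).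
  rewrite RintegralZl//; last exact: (integrable_itv_sub iv r0 tT).
  apply: le_trans (fL _ _) _; rewrite metric_sym.
  apply: (@le_trans _ _ (`|L| * mdist ((c : curve T X) r) ((c : curve T X) t))).
    by rewrite ler_wpM2r ?mdist_ge0// ler_norm.
  by rewrite ler_wpM2l//; exact: cv.
- by apply: chis; exact: ltW.
Qed.

End curves.

Section reweighting.
Context {R : realType} (T : R) (T0 : 0 < T) {X : completeMetricType R}.
Context (pi gpi : probability (borel (curve T X)) R) (g : curve T X -> R) (M : R).
Hypothesis mg : measurable_fun setT (g : borel (curve T X) -> R).
Hypothesis gM : forall c, `|g c| <= M.
Hypothesis gpiE : forall A : set (borel (curve T X)), measurable A ->
  gpi A = (\int[pi]_(c in A) (g c)%:E)%E.
Notation lam := (@lebesgue_measure R).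
Notation timeI := (`]0, T[%classic : set (measurableTypeR R)).

Let M0 : 0 <= M.
Proof. exact: le_trans (normr_ge0 _) (gM point). Qed.

(** A bounded weight multiplies the measure of a set by at most its bound, so that
    null sets and summability pass from [pi] to [gpi]. *)
Lemma reweighted_le (A : set (borel (curve T X))) : measurable A ->
  (gpi A <= mscale (NngNum M0) pi A)%E.
Proof.
move=> mA; rewrite gpiE//.
rewrite /mscale/= -integral_cst//.
apply: le_integral => //.
- apply: measurable_bounded_integrable => //.
  + by rewrite (le_lt_trans (probability_le1 _ mA))// ltry.
  + exact: measurable_funTS.
  + exists M; split; first exact: num_real.
    by move=> N MN c _; exact: le_trans (gM _) (ltW MN).
- exact: finite_measure_integrable_cst.
- by move=> c _; rewrite lee_fin (le_trans (ler_norm _)).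
Qed.

Lemma reweighted_dominates : gpi `<< pi.
Proof. exact: density_dominates mg gpiE. Qed.

Lemma reweighted_marginal_dominates t :
  distribution gpi (ev t) `<< distribution pi (ev t).
Proof.
apply/null_content_dominatesP => A mA A0.
have /null_content_dominatesP := reweighted_dominates; apply => //.
by rewrite -[X in measurable X]setTI; exact: ev_measurable.
Qed.

Lemma reweighted_summable (v : measurableTypeR R * borel (curve T X) -> R) :
  measurable_fun setT v ->
  (\int[lam]_(t in timeI) \int[pi]_c `|v (t, c)|%:E < +oo)%E ->
  (\int[lam]_(t in timeI) \int[gpi]_c `|v (t, c)|%:E < +oo)%E.
Proof.
move=> mv; have mI : measurable timeI by exact: measurable_itv.
have mv1 t : measurable_fun setT (fun c => `|v (t, c)|%:E).
  apply/measurable_EFinP; apply: measurableT_comp => //.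
  exact: (measurableT_comp mv (measurable_pair1 t)).
have mF (P : probability (borel (curve T X)) R) :
    measurable_fun setT (fun t => \int[P]_c `|v (t, c)|%:E)%E.
  apply: (measurable_fun_fubini_tonelli_F (fun z => `|v z|%:E)).
    by apply/measurable_EFinP; exact: measurableT_comp.
  by move=> z; rewrite lee_fin.
move=> fin.
apply: (@le_lt_trans _ _
  (\int[lam]_(t in timeI) (M%:E * \int[pi]_c `|v (t, c)|%:E))%E).
  apply: ge0_le_integral => //.
  - by move=> t _; apply: integral_ge0.
  - exact: measurable_funTS.
  - by apply: measurable_funeM; exact: measurable_funTS.
  - move=> t _; rewrite -[M]/((NngNum M0)%:num).
    rewrite -(ge0_integral_mscale pi measurableT (NngNum M0))//.
    by apply: ge0_le_measure_integral => //; exact: reweighted_le.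
rewrite ge0_integralZl//.
- by rewrite lte_mul_pinfty.
- exact: measurable_funTS.
- by move=> t _; apply: integral_ge0.
Qed.

End reweighting.

(** * The equivalence *)

Section equivalence.
Context {R : realType} (T : R) (T0 : 0 < T) {X : completeMetricType R}.
Context (m : {measure set (borel X) -> \bar R}) (hm : metric_measure_space m).
Context (b : R -> (X -> R) -> X -> R) (mb : time_measurable m T b).
Context (pi : probability (borel (curve T X)) R).
Notation lam := (@lebesgue_measure R).
Notation timeI := (`]0, T[%classic : set (measurableTypeR R)).
Hypothesis pi_abs : \forall t \ae lam,
  `]0, T[%classic t -> distribution pi (ev t) `<< m.
Hypothesis hsum : summable_along T b (fun t => distribution pi (ev t)).

Definition derivative_along_curves (f : X -> R) :=
  \forall z \ae (lam \x pi)%E, `]0, T[%classic z.1 ->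
    is_derive (z.1 : R) (1 : R) (fun t : R => f (ev t z.2) : R)
      (b z.1 f (ev z.1 z.2)).

(** Replaces [b] by its measurable version, and exchanges the quantifiers by
    cutting a null set along curves instead of times. *)
Lemma ae_is_derive_vel f (B : measurableTypeR R * borel X -> R) :
  (\forall z \ae (lam \x m)%E, `]0, T[%classic z.1 -> b z.1 f z.2 = B z) ->
  derivative_along_curves f ->
  \forall c \ae pi, \forall t \ae lam, timeI t ->
    is_derive t (1 : R) (obs f c) (vel B c t).
Proof.
move=> bB df.
have [N [mN N0 HN]] : \forall z \ae (lam \x pi)%E, timeI z.1 ->
    is_derive (z.1 : R) (1 : R) (obs f z.2) (vel B z.2 z.1).
  apply: (ae_imp2 _ df (ae_along_curves T0 hm pi_abs bB)) => -[t c]/= dfz bBz It.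
  apply/is_derive_obsE => //; rewrite /vel evcE; first by rewrite -bBz//; exact: dfz.
  by move: It; rewrite /= in_itv/= => /andP[t0 t1]; rewrite !ltW.
have := (@product_null_ysection _ _ _ _ _ lam pi N mN).1 N0.
apply: ae_imp => c Nc; exists (ysection N c); split => //.
  exact: measurable_ysection.
by move=> t /= nd; rewrite /ysection/= inE; apply: HN.
Qed.

Lemma continuity_equation_of_derivative
    (g : curve T X -> R) (gpi : probability (borel (curve T X)) R) :
  (forall f, Lip_bs f -> derivative_along_curves f) ->
  (\forall c \ae pi, abs_continuous_curve (c : curve T X)) ->
  continuous g -> bounded_fun g ->
  (forall A : set (borel (curve T X)), measurable A ->
     gpi A = (\int[pi]_(c in A) (g c)%:E)%E) ->
  solves_continuity_equation m T b
    (fun t => distribution gpi (ev t)) (distribution gpi (ev 0)).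
Proof.
move=> df piAC cg [M0 [_ hM0]] gpiE.
have mg : measurable_fun setT (g : borel (curve T X) -> R).
  exact: continuous_borel_measurable.
have gM c : `|g c| <= M0 + 1 by apply: hM0; rewrite ?ltrDl.
have gpi_abs : \forall t \ae lam, `]0, T[%classic t ->
    distribution gpi (ev t) `<< m.
  apply: ae_imp pi_abs => t abs_t tT.
  exact: null_dominates_trans (reweighted_marginal_dominates mg gpiE (t := t)) (abs_t tT).
have vel_fin f (B : measurableTypeR R * borel X -> R) : Lip_bs f -> measurable_fun setT B ->
    (\forall z \ae (lam \x m)%E, `]0, T[%classic z.1 -> b z.1 f z.2 = B z) ->
    (\int[lam]_(t in timeI) \int[gpi]_c `|vel B c t|%:E < +oo)%E.
  move=> Lf mB bB.
  apply: (reweighted_summable mg gM gpiE (measurable_vel T0 mB)).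
  by rewrite -(integral_norm_vel hm mB bB pi_abs); exact: hsum.
split => //.
  move=> f Lf; have [B mB bB] := mb (Lip_bs_Lip_b Lf).
  by rewrite (integral_norm_vel hm mB bB gpi_abs); exact: (vel_fin f).
move=> f chi Lf Cchi; have [B mB bB] := mb (Lip_bs_Lip_b Lf).
have vfin := vel_fin f B Lf mB bB.
apply/(continuity_equationE T0 hm Lf mB bB gpi_abs vfin Cchi).
have ae_gpi (Q : borel (curve T X) -> Prop) :
    (\forall c \ae pi, Q c) -> \forall c \ae gpi, Q c.
  move=> [N [mN N0 QN]]; exists N; split => //.
  by have /null_content_dominatesP := reweighted_dominates mg gpiE; exact.
have dvel := ae_gpi _ (ae_is_derive_vel bB (df f Lf)).
have AC := ae_gpi _ piAC.
have ivel := ae_vel_integrable T0 mB vfin.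
rewrite (ae_eq_Rintegral (g := fun c => - chi 0 * obs f c 0)).
  by rewrite RintegralZl ?mulNr//; exact: (integrable_obs T0 Lf).
apply: ae_imp2 ivel (ae_imp2 (fun c => @conj _ _) AC dvel) => c ic [ACc dc] _.
by rewrite mulNr; exact: weak_pairing_of_is_derive Cchi.
Qed.

(** The functional [Psi] is orthogonal to all continuous [g] with values in
    [[0, 1]]: unless [g] vanishes almost everywhere, [g] divided by its integral
    is the density of a probability, for which the continuity equation gives
    [\int Psi = 0]. *)
Lemma weak_pairing_of_continuity_equation f
    (B : measurableTypeR R * borel X -> R) (chi : R -> R) :
  (forall g : curve T X -> R, continuous g -> bounded_fun g ->
    forall gpi : probability (borel (curve T X)) R,
      (forall A : set (borel (curve T X)), measurable A ->
         gpi A = (\int[pi]_(c in A) (g c)%:E)%E) ->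
      solves_continuity_equation m T b
        (fun t => distribution gpi (ev t)) (distribution gpi (ev 0))) ->
  Lip_bs f -> measurable_fun setT B ->
  (\forall z \ae (lam \x m)%E, `]0, T[%classic z.1 -> b z.1 f z.2 = B z) ->
  C1_c T chi ->
  \forall c \ae pi, weak_pairing T (obs f c) (vel B c) chi =
                    - (chi 0 * obs f c 0).
Proof.
move=> CE Lf mB bB Cchi.
have vfin : (\int[lam]_(t in timeI) \int[pi]_c `|vel B c t|%:E < +oo)%E.
  by rewrite -(integral_norm_vel hm mB bB pi_abs); exact: hsum.
pose Psi (c : borel (curve T X)) := weak_pairing T (obs f c) (vel B c) chi + chi 0 * obs f c 0.
have iPsi (P : probability (borel (curve T X)) R) :
    (\int[lam]_(t in timeI) \int[P]_c `|vel B c t|%:E < +oo)%E ->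
    P.-integrable setT (EFin \o Psi).
  move=> Pfin; apply: integrable_addr => //.
    exact: (integrable_weak_pairing T0 Lf mB Pfin Cchi).
  by apply: integrable_scaler => //; exact: integrable_obs.
suff : \forall c \ae pi, Psi c = 0.
  by apply: ae_imp => c /eqP; rewrite addr_eq0 => /eqP.
apply: (ae_eq0_of_continuous_duality _ (iPsi _ vfin)).
  move=> U oU; exists (open_cutoff U); split.
  - exact: open_cutoff_continuous.
  - exact: open_cutoff_itv.
  - by move=> c; exact: open_cutoff_cvg.
move=> g cg g01.
have mg : measurable_fun setT (g : borel (curve T X) -> R).
  exact: continuous_borel_measurable.
have g0 c : 0 <= g c by have /andP[] := g01 c.
have mPsig : measurable_fun setT (fun c => (Psi c * g c)%:E).
  apply/measurable_EFinP; apply: measurable_funM => //.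
  by apply/measurable_EFinP; exact: measurable_int (iPsi _ vfin).
have ig : pi.-integrable setT (EFin \o (g : borel (curve T X) -> R)).
  apply: measurable_bounded_integrable => //.
    by rewrite /= probability_setT ltry.
  exists 1; split; first exact: num_real.
  move=> N N1 c _ /=; rewrite ger0_norm//; apply: le_trans (ltW N1).
  by have /andP[] := g01 c.
pose z := \int[pi]_c g c.
have zE : (\int[pi]_c (g c)%:E = z%:E)%E.
  by rewrite fineK//; exact: integrable_fin_num ig.
have z0 : 0 <= z by apply: Rintegral_ge0.
have [z_eq0|z_neq0] := eqVneq z 0.
  have gae : ae_eq pi setT (EFin \o g) (cst 0%E).
    apply/(ae_eq_integral_abs pi measurableT); first exact/measurable_EFinP.
    rewrite -[RHS]/((0 : R)%:E) -z_eq0 -zE; apply: eq_integral => c _.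
    by rewrite /= ger0_norm.
  rewrite (ae_eq_integral_nomeas (g := cst 0%E)) ?integral0//.
  by apply: ae_imp gae => c /(_ I)[->]; rewrite mulr0.
have z_gt0 : 0 < z by rewrite lt_neqAle eq_sym z_neq0.
pose h c := z^-1 * g c.
have mh : measurable_fun setT (h : borel (curve T X) -> R).
  exact: measurable_funM.
have h0 c : 0 <= h c by rewrite mulr_ge0// invr_ge0.
have h1 : (\int[pi]_c (h c)%:E = 1)%E.
  under eq_integral do rewrite EFinM.
  by rewrite integralZl// zE -EFinM mulVf.
pose gpi : probability (borel (curve T X)) R := density_probability mh h0 h1.
have gpiE (A : set (borel (curve T X))) : measurable A ->
    gpi A = (\int[pi]_(c in A) (h c)%:E)%E by [].
have [gpi_abs gpi_sum gpi_CE] : solves_continuity_equation m T b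
    (fun t => distribution gpi (ev t)) (distribution gpi (ev 0)).
  apply: (CE h) => //.
    move=> c; apply: (@cvgM _ _ (nbhs c) _ (cst z^-1) g); last exact: cg.
    exact: cvg_cst.
  exists z^-1; split; first exact: num_real.
  move=> N Nz c _ /=; rewrite ger0_norm//; apply: le_trans (ltW Nz).
  by rewrite /h ler_piMr ?invr_ge0//; have /andP[] := g01 c.
have gpi_fin : (\int[lam]_(t in timeI) \int[gpi]_c `|vel B c t|%:E < +oo)%E.
  by rewrite -(integral_norm_vel hm mB bB gpi_abs); exact: gpi_sum.
have Psi_gpi : (\int[gpi]_c (Psi c)%:E)%E = 0%E.
  have /(continuity_equationE T0 hm Lf mB bB gpi_abs gpi_fin Cchi) wE :=
    gpi_CE f chi Lf Cchi.
  rewrite -[LHS]fineK; last exact: integrable_fin_num (iPsi _ gpi_fin).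
  rewrite -/(Rintegral gpi setT Psi) RintegralD//; last 2 first.
    exact: (integrable_weak_pairing T0 Lf mB gpi_fin Cchi).
    by apply: integrable_scaler => //; exact: integrable_obs.
  rewrite RintegralZl//; last exact: integrable_obs.
  by rewrite wE addNr.
rewrite (integral_density mh gpiE (iPsi _ gpi_fin)) in Psi_gpi.
have -> : (\int[pi]_c (Psi c * g c)%:E = \int[pi]_c (z%:E * (Psi c * h c)%:E))%E.
  by apply: eq_integral => c _; rewrite -EFinM /h; congr EFin; field.
have iPsih : pi.-integrable setT (fun c => (Psi c * h c)%:E).
  have : pi.-integrable setT (EFin \o (fun c => h c * Psi c)).
    apply: (@integrable_bounded_mulr _ _ _ pi _ measurableT h Psi z^-1) => //.
      move=> c _; rewrite ger0_norm// /h ler_piMr ?invr_ge0//.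
      by have /andP[] := g01 c.
    exact: iPsi.
  by apply: eq_integrable => // c _ /=; rewrite mulrC.
by rewrite integralZl// Psi_gpi mule0.
Qed.

(** The countable family of cut-offs is enumerated by [unpickle], so that one null
    set of curves serves for all of them. *)
Lemma derivative_of_continuity_equation f :
  (forall g : curve T X -> R, continuous g -> bounded_fun g ->
    forall gpi : probability (borel (curve T X)) R,
      (forall A : set (borel (curve T X)), measurable A ->
         gpi A = (\int[pi]_(c in A) (g c)%:E)%E) ->
      solves_continuity_equation m T b
        (fun t => distribution gpi (ev t)) (distribution gpi (ev 0))) ->
  Lip_bs f -> derivative_along_curves f.
Proof.
move=> CE Lf; have [B mB bB] := mb (Lip_bs_Lip_b Lf).
have vfin : (\int[lam]_(t in timeI) \int[pi]_c `|vel B c t|%:E < +oo)%E.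
  by rewrite -(integral_norm_vel hm mB bB pi_abs); exact: hsum.
have weak : \forall c \ae pi, forall k : nat,
    if unpickle k is Some (q, n) then
      (0 < ratr q :> R -> ratr q + 2 * n.+1%:R^-1 < T ->
       weak_pairing T (obs f c) (vel B c) (cutoff (ratr q) n.+1%:R^-1) =
       - (cutoff (ratr q) n.+1%:R^-1 0 * obs f c 0)) : Prop
    else True.
  apply: ae_foralln => k; case: unpickle => [[q n]|]; last exact: aeW.
  have [qn|qn] := pselect (ratr q + 2 * n.+1%:R^-1 < T); last first.
    by apply: aeW => c _ /qn.
  have Cchi : C1_c T (cutoff (ratr q : R) n.+1%:R^-1).
    by apply: cutoff_C1_c => //; rewrite invr_ge0.
  by apply: ae_imp (weak_pairing_of_continuity_equation CE Lf mB bB Cchi) => c.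
have dvel : \forall c \ae pi, \forall t \ae lam, timeI t ->
    is_derive t (1 : R) (obs f c) (vel B c t).
  apply: ae_imp2 (ae_vel_integrable T0 mB vfin) weak => c ic wc.
  apply: (is_derive_of_weak T0 _ ic).
    exact/continuous_subspaceT/obs_continuous.
  by move=> q n q0 qn; have := wc (pickle (q, n)); rewrite pickleK; exact.
pose N := [set z : measurableTypeR R * borel (curve T X) | timeI z.1] `&`
  [set z | ~ is_derive (z.1 : R) (1 : R) (obs f z.2) (vel B z.2 z.1)].
have mN : measurable N.
  apply: measurableI.
    rewrite (_ : [set _ | _] = timeI `*` setT); last first.
      by apply/seteqP; split => [z|z []].
    by apply: measurableX => //; exact: measurable_itv.
  apply: (@measurable_not_is_derive R _ (borel (curve T X))
    (fun z => obs f z.2 z.1) (fun z => vel B z.2 z.1)).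
  - by move=> c; exact: obs_continuous.
  - exact: measurable_obs.
  - exact: measurable_vel.
have N0 : (lam \x pi)%E N = 0%E.
  apply/product_null_ysection => //; apply: ae_imp dvel => c [A [mA A0 HA]].
  apply: (subset_measure0 _ mA _ A0); first exact: measurable_ysection.
  move=> t; rewrite /ysection/= inE => -[It nd]; apply: HA => /= /(_ It).
  exact: nd.
have aeN : \forall z \ae (lam \x pi)%E, ~ N z.
  by exists N; split => // z /= /contrapT.
apply: (ae_imp2 _ aeN (ae_along_curves T0 hm pi_abs bB)) => -[t c]/= nN bBz It.
apply/is_derive_obsE => //.
have -> : b t f (ev t c) = vel B c t.
  rewrite bBz// /vel evcE//.
  by move: It; rewrite /= in_itv/= => /andP[t0 t1]; rewrite !ltW.
by apply: contrapT => nd; apply: nN.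
Qed.

End equivalence.

Unset Implicit Arguments.
Set Strict Implicit.
Set Printing Implicit Defensive.

Theorem proposition7p6 (R : realType) (X : completeMetricType R)
  (m : {measure set (borel X) -> \bar R}) (T : R)
  (b : R -> (X -> R) -> X -> R) (pi : probability (borel (curve T X)) R)
  (hm : metric_measure_space m) (T_gt0 : 0 < T)
  (hb : forall t, 0 < t < T -> Der1_loc m (b t))
  (mb : time_measurable m T b)
  (piAC : \forall g \ae pi, abs_continuous_curve (g : curve T X))
  (pi_abs : \forall t \ae @lebesgue_measure R,
     `]0, T[%classic t -> distribution pi (ev t) `<< m)
  (hsum : summable_along T b (fun t => distribution pi (ev t))) :
  (forall f : X -> R, Lip_bs f ->
     \forall z \ae (@lebesgue_measure R \x pi)%E, `]0, T[%classic z.1 ->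
       is_derive (z.1 : R) (1 : R) (fun t : R => f (ev t z.2) : R)
         (b z.1 f (ev z.1 z.2)))
  <->
  (forall g : curve T X -> R, continuous g -> bounded_fun g ->
     forall gpi : probability (borel (curve T X)) R,
       (forall A : set (borel (curve T X)), measurable A ->
          gpi A = (\int[pi]_(c in A) (g c)%:E)%E) ->
       solves_continuity_equation m T b
         (fun t => distribution gpi (ev t)) (distribution gpi (ev 0))).
Proof.
split=> [df g cg bg gpi gpiE|CE f Lf].
  exact: (continuity_equation_of_derivative T_gt0 hm mb pi_abs hsum df piAC
    cg bg gpiE).
exact: (derivative_of_continuity_equation T_gt0 hm mb pi_abs hsum CE Lf).
Qed.
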